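(* Let $\theta=t\frac{d}{dt}$ and $\mathcal L_2(t,\theta)=\theta^2-t(10\theta^2+10\theta+3)+9t^2(\theta+1)^2$. Let $\phi(t)$ be the analytic at $t=0$ solution of $\mathcal L_2\phi=0$ with $\phi(t)=1+3t+O(t^2)$, and let $\psi(t)$ be the analytic at $t=0$ solution of $\mathcal L_2\psi=\frac{t}{1-t}$ with $\psi(t)=t+O(t^2)$. Then \[ m(P_3)=-\mathrm{Re}\,\Bigl(t\frac{d}{dt}\Bigr)^{-1}\Bigl[\frac34\phi(t)+\frac{6}{\pi^2}\psi(t)\Bigr]\Big|_{t=\infty}. \]
   Context: For a Laurent polynomial $P$ in $n$ variables, $m(P)=\frac{1}{(2\pi i)^n}\int_{|x_i|=1}\log|P|\,\frac{dx_1}{x_1}\cdots\frac{dx_n}{x_n}$ is its Mahler measure, and $P_3=(1+x_1+x_2+x_3)(1+x_1^{-1}+x_2^{-1}+x_3^{-1})$ (so $m(P_3)=2m(1+x_1+x_2+x_3)$). Convention: for a power series $b(t)=\sum_{m\ge0}b_mt^m$ convergent near $0$, $\bigl(t\frac{d}{dt}\bigr)^{-1}b(t)=b_0\log t+\sum_{m\ge1}\frac{b_m}{m}t^m$; this function is analytically continued along the negative real half-axis $-\infty<t<0$, and the expression $-\mathrm{Re}\,(\cdot)|_{t=\infty}$ denotes the limit of minus its real part as $t\to-\infty$ along this half-axis (the real part does not depend on the branch of $\log t$). *)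

(* Defs.v *)
From mathcomp Require Import all_boot all_algebra.
From mathcomp Require Import all_classical all_reals all_analysis.
From mathcomp Require Import complex.
Import GRing.Theory Num.Theory.
Import numFieldNormedType.Exports.

Set Implicit Arguments.
Unset Strict Implicit.
Unset Printing Implicit Defensive.

Local Open Scope ring_scope.
Local Open Scope classical_set_scope.

Section Defs.
Variable R : realType.

Definition expi (th : R) : R[i] := (cos th +i* sin th)%C.

Definition P3 (x1 x2 x3 : R[i]) : R[i] :=
  (1 + x1 + x2 + x3) * (1 + x1^-1 + x2^-1 + x3^-1).

Definition I02pi : set R := `[0%R, (2 * pi)%R].

Definition mahler_P3 : \bar R :=
  (((2 * pi) ^+ 3)^-1 : R)%:E *
  (\int[((@lebesgue_measure R) \x (@lebesgue_measure R)) \x (@lebesgue_measure R)]_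
     (p in (I02pi `*` I02pi) `*` I02pi)
     (ln (Normc.normc (P3 (expi p.1.1) (expi p.1.2) (expi p.2))))%:E)%E.

(** Coefficient of t^n in L_2(t,theta) applied to the formal power series
    sum_k a_k t^k, where
    L_2 = theta^2 - t(10 theta^2 + 10 theta + 3) + 9 t^2 (theta+1)^2, theta = t d/dt.
    (theta t^k = k t^k, so the coefficient of t^n is
     n^2 a_n - (10(n-1)^2 + 10(n-1) + 3) a_{n-1} + 9 (n-1)^2 a_{n-2}.) *)
Definition L2coef (a : nat -> R) (n : nat) : R :=
  (n%:R) ^+ 2 * a n
  - (if n is k.+1 then (10 * (k%:R) ^+ 2 + 10 * k%:R + 3) * a k else 0)
  + (if n is k.+2 then 9 * ((k.+1)%:R) ^+ 2 * a k else 0).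

Definition t_over_1mt_coef (n : nat) : R := if n is _.+1 then 1 else 0.

Definition real_analytic_on (D : set R) (g : R -> R) : Prop :=
  forall x0, D x0 -> exists2 r : R, 0 < r &
    exists e : nat -> R, forall x, `|x - x0| < r ->
      series (fun k => e k * (x - x0) ^+ k) n @[n --> \oo] --> g x.

End Defs.

(* Main.v *)
(* Idea. By Jensen's formula in the third variable, m(P_3) is the mean of log^+ s over the
   torus, where s = |1 + e^(ia) + e^(ib)|^2.  Since
   s - 1 = 8 cos(a/2) cos(b/2) cos((a-b)/2), the region s > 1 is a hexagon, of relative area
   3/4, on whose boundary s = 1.  The moments c_n of s over this hexagon satisfy the recurrence
   of L_2 up to the divergence of an explicit vector field, and the flux through the boundary
   contributes the constant 6/pi^2 for every n >= 1; hence c_n is the n-th Taylor coefficient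
   of (3/4) phi + (6/pi^2) psi.  Therefore (t d/dt)^(-1) of this series is
   c_0 log t minus the mean of log(1 - t s) over the hexagon, which continues along
   t < 0 and tends to minus the mean of log s there, i.e. to -m(P_3). *)
Require Import Defs.
From HB Require Import structures.
From mathcomp Require Import all_boot all_order all_algebra.
From mathcomp Require Import all_classical all_reals all_analysis.
From mathcomp Require Import complex.
From mathcomp Require Import measurable_realfun ring lra.
Import Order.TTheory GRing.Theory Num.Theory.
Import numFieldNormedType.Exports.
Local Open Scope ring_scope.
Local Open Scope classical_set_scope.
Set Implicit Arguments.
Unset Strict Implicit.
Unset Printing Implicit Defensive.

(** Over the whole torus the moments of s satisfy the recurrence of L_2 with right-hand side 0,
    because the vector field is periodic; only the cut along s = 1 produces a flux. That flux does
    not depend on n for two reasons: every power of s equals 1 on the cut, and the part of the field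
    that carries a factor n is tangent to the cut. The limit at minus infinity is harmless because s
    > 1 on the hexagon: log(1 - ts) - log(-t) tends to log s uniformly there. Two obstacles shape
    the rest. Jensen's formula is needed only off the circle |w| = 1, where the integrand is
    continuous, so a null set has to be removed from the torus. Fubini needs log |P_3| to be
    integrable although it is unbounded below; this comes out of Jensen's formula itself, from an
    upper bound of the integrand and the nonnegativity of its mean. *)

(** * Calculus of one variable *)

Section OneVariable.
Context {R : realType}.
Implicit Types (f F : R -> R) (a b x y : R).
Notation mu := (@lebesgue_measure R).

Lemma Rintegral_is_derive F f a b : a <= b -> continuous f ->
  (forall x, a <= x <= b -> is_derive x 1 F (f x)) ->
  \int[mu]_(x in `[a, b]) f x = F b - F a.
Proof.
rewrite le_eqVlt => /predU1P[-> _ _|ab cf dF].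
  by rewrite set_itv1 Rintegral_set1 subrr.
have cF x : a <= x <= b -> F @ x --> F x.
  by move=> /dF [/derivable1_diffP/differentiable_continuous].
rewrite /Rintegral (@continuous_FTC2 _ f F)//.
- exact: continuous_subspaceT.
- split.
  + by move=> x /[!in_itv]/= /andP[ax xb]; have [] := dF x; rewrite ?(ltW ax) ?(ltW xb).
  + by apply: cvg_at_right_filter; apply: cF; rewrite lexx ltW.
  + by apply: cvg_at_left_filter; apply: cF; rewrite lexx ltW.
- move=> x /[!in_itv]/= /andP[ax xb]; rewrite derive1E.
  by have [|_ ->] := dF x; rewrite ?(ltW ax) ?(ltW xb).
Qed.

Lemma continuous_primitive f a : continuous f ->
  exists F, forall x, a < x -> is_derive x 1 F (f x).
Proof.
move=> cf; exists (fun x => \int[mu]_(t in `[a, x]) f t) => x ax.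
have xu : x < x + 1 by rewrite ltrDl.
have fi : mu.-integrable `[a, x + 1] (EFin \o f).
  apply: continuous_compact_integrable; first exact: segment_compact.
  exact: continuous_subspaceT.
have [dF] := continuous_FTC1_closed xu fi ax (cf x).
by rewrite derive1E => <-; exact: derivableP.
Qed.

Lemma continuous_itv_integrable f a b : continuous f ->
  mu.-integrable `[a, b] (EFin \o f).
Proof.
move=> cf; apply: continuous_compact_integrable; first exact: segment_compact.
exact: continuous_subspaceT.
Qed.

End OneVariable.

(** * Jensen's formula for a linear polynomial on the unit circle *)

Section Jensen.
Context {R : realType}.
Implicit Types (u v t : R).
Notation mu := (@lebesgue_measure R).

(** With [w = u + iv] this is [|w + e^(it)|^2], so [ln Q] is twice the usual integrand of Jensen's
    formula. *)
Let Q u v t : R := (u + cos t) ^+ 2 + (v + sin t) ^+ 2.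

Let QE u v t : Q u v t = u ^+ 2 + v ^+ 2 + 1 + 2 * (u * cos t + v * sin t).
Proof. by rewrite /Q; have E := sin2cos2 t; ring: E. Qed.

Let Q_gt0 u v t : u ^+ 2 + v ^+ 2 != 1 -> 0 < Q u v t.
Proof.
move=> w1; rewrite lt_neqAle eq_sym addr_ge0 ?sqr_ge0// andbT.
apply: contra w1; rewrite paddr_eq0 ?sqr_ge0// !sqrf_eq0 !addr_eq0.
by move=> /andP[/eqP-> /eqP->]; rewrite !sqrrN cos2Dsin2.
Qed.

Let continuous_Q u v : continuous (Q u v).
Proof.
move=> t; rewrite /Q; apply: cvgD; under eq_fun do rewrite expr2; apply: cvgM;
  apply: cvgD; (try exact: cvg_cst);
  [exact: continuous_cos|exact: continuous_cos|exact: continuous_sin|exact: continuous_sin].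
Qed.

Let continuous_lnQ u v : u ^+ 2 + v ^+ 2 != 1 -> continuous (fun t => ln (Q u v t)).
Proof.
move=> w1 t; apply: (@continuous_comp _ _ _ (Q u v) (@ln R)); first exact: continuous_Q.
exact/continuous_ln/Q_gt0.
Qed.

Let J u v : R := \int[mu]_(t in `[0, 2 * pi]) ln (Q u v t).

Let QDpi u v t : Q u v (t + pi) = Q (- u) (- v) t.
Proof. by rewrite /Q cosDpi sinDpi; ring. Qed.

Let QM u v t : Q u v t * Q (- u) (- v) t = Q (v ^+ 2 - u ^+ 2) (- (2 * u * v)) (2 * t).
Proof.
rewrite /Q (_ : 2 * t = t + t) ?cosD ?sinD; last by ring.
have E : sin t ^+ 2 = 1 - cos t ^+ 2 by exact: sin2cos2.
ring: E.
Qed.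

(* Splitting the circle into halves turns [ln |w + z| + ln |w - z|] into [ln |w^2 - z^2|]. *)
Let J_sqr u v : u ^+ 2 + v ^+ 2 != 1 ->
  J u v = J (v ^+ 2 - u ^+ 2) (- (2 * u * v)) / 2.
Proof.
move=> w1; have w1' : (- u) ^+ 2 + (- v) ^+ 2 != 1 by rewrite !sqrrN.
set a := v ^+ 2 - u ^+ 2; set b := - (2 * u * v).
have w2 : a ^+ 2 + b ^+ 2 != 1.
  have -> : a ^+ 2 + b ^+ 2 = (u ^+ 2 + v ^+ 2) ^+ 2 by rewrite /a /b; ring.
  rewrite sqrf_eq1 negb_or w1/= gt_eqF// (@lt_le_trans _ _ 0)//.
  by rewrite addr_ge0 ?sqr_ge0.
(* Starting the primitives at -1 makes them differentiable at 0 as well. The substitutions by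
   [t + pi] and [2 * t] then become the chain rule for [F] and [G]. *)
have [F dF] := continuous_primitive (-1) (continuous_lnQ w1).
have [G dG] := continuous_primitive (-1) (continuous_lnQ w2).
have pi0 : 0 < pi :> R := pi_gt0 R.
have JF : J u v = F (2 * pi) - F 0.
  apply: Rintegral_is_derive; [lra|exact: continuous_lnQ|].
  by move=> x /andP[x0 _]; apply: dF; lra.
have JG : J a b = G (2 * pi) - G 0.
  apply: Rintegral_is_derive; [lra|exact: continuous_lnQ|].
  by move=> x /andP[x0 _]; apply: dG; lra.
pose h t : R := ln (Q u v t) + ln (Q (- u) (- v) t).
have ch : continuous h.
  by move=> t; apply: cvgD; [exact: (continuous_lnQ w1)|exact: (continuous_lnQ w1')].
have hF : \int[mu]_(t in `[0, pi]) h t = (F pi + F (pi + pi)) - (F 0 + F (0 + pi)).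
  apply: (@Rintegral_is_derive _ (fun t => F t + F (t + pi)) h) => //; first exact: ltW.
  move=> x /andP[x0 _]; apply: is_deriveD; first by apply: dF; lra.
  rewrite -(QDpi u v); have := dF (x + pi) ltac:(lra) => dFx.
  by apply: is_derive_eq; rewrite addr0 mulr1.
have hG : \int[mu]_(t in `[0, pi]) h t = G (2 * pi) / 2 - G (2 * 0) / 2.
  apply: (@Rintegral_is_derive _ (fun t => G (2 * t) / 2) h) => //; first exact: ltW.
  move=> x /andP[x0 _]; rewrite /h -lnM ?posrE ?Q_gt0// QM -/a -/b.
  have := dG (2 * x) ltac:(lra) => dGx.
  by apply: is_derive_eq; rewrite /GRing.scale/=; field.
have EG : J a b = 2 * ((F pi + F (pi + pi)) - (F 0 + F (0 + pi))).
  by rewrite -hF hG JG mulr0; field.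
rewrite EG JF add0r mulrDl mul1r; lra.
Qed.


(** The values at [t] and [t + pi] have product [(s + 1)^2 - 4 p^2 >= (1 - s)^2], and each is at
    most 4; dividing gives the lower bound without any square root. *)
Let Q_bounds r u v t : r < 1 -> u ^+ 2 + v ^+ 2 <= r ->
  (1 - r) ^+ 2 / 4 <= Q u v t <= 4.
Proof.
move=> r1 sr; rewrite QE; set s := u ^+ 2 + v ^+ 2; set p := u * cos t + v * sin t.
have s0 : 0 <= s by rewrite addr_ge0 ?sqr_ge0.
have ps : p ^+ 2 <= s.
  have -> : s = p ^+ 2 + (u * sin t - v * cos t) ^+ 2.
    by rewrite /p /s; have E := sin2cos2 t; ring: E.
  by rewrite lerDl sqr_ge0.
have sr' : s <= r by [].
have h1 : 0 <= (p - 1) ^+ 2 by exact: sqr_ge0.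
have h2 : 0 <= (p + 1) ^+ 2 by exact: sqr_ge0.
have hm : 0 <= s + 1 - 2 * p <= 4 by nra.
have hp : 0 <= s + 1 + 2 * p <= 4 by nra.
have prod : (1 - r) ^+ 2 <= (s + 1 + 2 * p) * (s + 1 - 2 * p) by nra.
apply/andP; split; last by case/andP: hp.
by rewrite ler_pdivrMr//; move: hm hp prod => /andP[m0 m4] /andP[p0 p4] pr; nra.
Qed.

Let J_bounded r : 0 <= r -> r < 1 ->
  exists C, forall u v, u ^+ 2 + v ^+ 2 <= r -> `|J u v| <= C.
Proof.
move=> r0 r1; set d := (1 - r) ^+ 2 / 4.
have d0 : 0 < d by rewrite divr_gt0// exprn_gt0// subr_gt0.
have d1 : d <= 1 by rewrite ler_pdivrMr// mul1r; nra.
exists ((ln 4 - ln d) * fine (mu `[0, 2 * pi])) => u v uvr.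
have w1 : u ^+ 2 + v ^+ 2 != 1 by rewrite lt_eqF// (le_lt_trans uvr).
have cl := continuous_lnQ w1.
apply: (le_trans (le_normr_Rintegral _ _)) => //; first exact: continuous_itv_integrable.
rewrite -Rintegral_cst//; apply: le_Rintegral => //.
- by apply: continuous_itv_integrable => t; apply: cvg_norm; exact: cl.
- by apply: continuous_itv_integrable => t; exact: cvg_cst.
move=> t _; have /andP[Q1 Q2] := Q_bounds t r1 uvr.
have l0 : ln d <= 0 by exact: ln_le0.
have l4 : 0 <= ln 4 :> R by apply: ln_ge0; lra.
have lQ1 : ln d <= ln (Q u v t) by rewrite ler_ln ?posrE ?Q_gt0.
have lQ2 : ln (Q u v t) <= ln 4 by rewrite ler_ln ?posrE ?Q_gt0.
by rewrite ler_norml; apply/andP; split; lra.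
Qed.

(** By [J_sqr], [J] at [w] is half of [J] at [-w^2], and the map from [w] to [-w^2] preserves the
    disk [|w|^2 <= r], where [J] is bounded by some [C]. After [n] iterations [|J| * 2^n <= C],
    which forces [J = 0]. No mean value property is involved. *)
Let J_eq0 u v : u ^+ 2 + v ^+ 2 < 1 -> J u v = 0.
Proof.
move=> w1; set r := u ^+ 2 + v ^+ 2.
have r0 : 0 <= r by rewrite addr_ge0 ?sqr_ge0.
have [C JC] := J_bounded r0 w1.
have JCn n : forall a b, a ^+ 2 + b ^+ 2 <= r -> `|J a b| * 2 ^+ n <= C.
  elim: n => [|n ih] a b abr; first by rewrite expr0 mulr1 JC.
  rewrite J_sqr; last by rewrite lt_eqF// (le_lt_trans abr).
  rewrite normrM [`|2^-1|]ger0_norm// (exprS 2 n) mulrA mulfVK//; apply: ih.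
  have -> : (b ^+ 2 - a ^+ 2) ^+ 2 + (- (2 * a * b)) ^+ 2 = (a ^+ 2 + b ^+ 2) ^+ 2.
    by ring.
  have ab0 : 0 <= a ^+ 2 + b ^+ 2 by rewrite addr_ge0 ?sqr_ge0.
  by rewrite (le_trans _ abr)// expr2 ler_piMr// (le_trans abr)// ltW.
apply/eqP/contraT => J0; have J0' : 0 < `|J u v| by rewrite normr_gt0.
(* Used only to get an exponent [n] with [C / |J u v| < 2 ^+ n]. *)
have := upper_nthrootP (leqnn (Num.bound (C / `|J u v|))).
rewrite ltr_pdivrMr// ltNge => /negP; elim.
by rewrite mulrC JCn.
Qed.

(** Outside the disk, inversion in the unit circle reduces to [J_eq0]: with [s = |w|^2],
    [|w + z|^2 = s |w/s + z|^2] for [|z| = 1], and [w/s] lies inside. *)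
Lemma jensen_circle u v : u ^+ 2 + v ^+ 2 != 1 ->
  \int[mu]_(t in `[0, 2 * pi]) ln ((u + cos t) ^+ 2 + (v + sin t) ^+ 2) =
  2 * pi * ln (Num.max (u ^+ 2 + v ^+ 2) 1).
Proof.
move=> w1; rewrite -/(J u v); have [w_le1|w_gt1] := leP.
  by rewrite ln1 mulr0 J_eq0// lt_neqAle w1.
set s := u ^+ 2 + v ^+ 2 in w1 w_gt1 *.
have s0 : 0 < s by rewrite (lt_trans _ w_gt1).
have w'1 : (u / s) ^+ 2 + (v / s) ^+ 2 < 1.
  have -> : (u / s) ^+ 2 + (v / s) ^+ 2 = s^-1.
    by rewrite !expr_div_n -mulrDl -/s; field; rewrite gt_eqF.
  by rewrite invf_lt1.
have QV t : Q u v t = s * Q (u / s) (v / s) t.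
  by rewrite !QE !expr_div_n; move: w_gt1; rewrite /s => w_gt1; field; rewrite gt_eqF.
transitivity (\int[mu]_(t in `[0, 2 * pi]) (ln s + ln (Q (u / s) (v / s) t))).
  by apply: eq_Rintegral => t _; rewrite QV lnM ?posrE ?Q_gt0 ?lt_eqF.
rewrite RintegralD//; last 2 first.
- by apply: continuous_itv_integrable => t; exact: cvg_cst.
- by apply: continuous_itv_integrable; apply: continuous_lnQ; rewrite lt_eqF.
rewrite -/(J (u / s) (v / s)) J_eq0// addr0 Rintegral_cst//.
have pi0 : 0 < 2 * pi :> R by rewrite mulr_gt0// pi_gt0.
by rewrite /= lebesgue_measure_itv/= lte_fin pi0/= subr0 mulrC.
Qed.

Lemma norm_circle_gt0 u v t : u ^+ 2 + v ^+ 2 != 1 ->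
  0 < (u + cos t) ^+ 2 + (v + sin t) ^+ 2.
Proof. exact: Q_gt0. Qed.

Lemma continuous_ln_norm u v : u ^+ 2 + v ^+ 2 != 1 ->
  continuous (fun t => ln ((u + cos t) ^+ 2 + (v + sin t) ^+ 2)).
Proof. exact: continuous_lnQ. Qed.

End Jensen.

(** * Remainder of the logarithmic series *)

Section LogSeries.
Context {R : realType}.
Implicit Types (x y z : R).

Let lnT n x : R := ln (1 - x) + series (fun k => x ^+ k.+1 / k.+1%:R) n.

Let is_derive_lnT n x : `|x| <= 2^-1 -> is_derive x 1 (lnT n) (- (x ^+ n / (1 - x))).
Proof.
move=> /ler_normlP[_ x2]; have x1 : 0 < 1 - x by lra.
elim: n => [|n ih].
  have -> : lnT 0 = fun x => ln (1 - x).
    by apply/funext => t; rewrite /lnT /series/= big_geq// addr0.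
  have dln := is_derive1_ln x1.
  by apply: is_derive_eq; rewrite add0r mul1r mulrN1 expr0 mul1r.
have -> : lnT n.+1 = lnT n + (n.+1%:R)^-1 \*: (@idfun R ^+ n.+1).
  apply/funext => t; rewrite /lnT seriesSr addrA [RHS]/= /GRing.scale/=.
  by congr +%R; rewrite mulrC exprfctE.
apply: is_derive_eq; rewrite /GRing.scale/= exprS mulr1 mulKf ?pnatr_eq0//.
by field; rewrite gt_eqF.
Qed.

Let continuous_at_lnT n x : `|x| <= 2^-1 -> {for x, continuous (lnT n)}.
Proof.
move=> /(is_derive_lnT n) [+ _].
by move=> /derivable1_diffP/differentiable_continuous.
Qed.

(** The remainder [lnT n] vanishes at 0 and has derivative [- x^n / (1 - x)], so the mean value
    theorem applies. For [|z| <= 1/2] the factor [|z| / |1 - c|] is at most 1, leaving an error that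
    is uniform in [z]. *)
Lemma ln1B_series_bound n z : `|z| <= 2^-1 ->
  `|ln (1 - z) + series (fun k => z ^+ k.+1 / k.+1%:R) n| <= 2^-1 ^+ n.
Proof.
move=> z2; rewrite -/(lnT n z).
have lnT0 : lnT n 0 = 0.
  rewrite /lnT subr0 ln1 add0r /series/= big1// => i _.
  by rewrite expr0n/= mul0r.
have bd c : `|c| <= `|z| -> `|- (c ^+ n / (1 - c)) * z| <= 2^-1 ^+ n.
  move=> cz; have c2 : `|c| <= 2^-1 by exact: le_trans z2.
  have /ler_normlP[_ c2'] := c2.
  have c1 : 2^-1 <= `|1 - c| by rewrite ger0_norm; lra.
  have nc1 : 0 < `|1 - c| by rewrite (lt_le_trans _ c1).
  rewrite normrM normrN normf_div normrX -mulrA.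
  have : `|1 - c|^-1 * `|z| <= 1 by rewrite mulrC ler_pdivrMr// mul1r (le_trans z2).
  have p0 : 0 <= `|c| ^+ n by rewrite exprn_ge0.
  have p1 : `|c| ^+ n <= 2^-1 ^+ n by rewrite lerXn2r ?nnegrE.
  by move=> q1; rewrite (le_trans _ p1)// ler_piMr.
have [z0|z0] := leP 0 z.
  have [||c] := @MVT_segment _ (lnT n) (fun c => - (c ^+ n / (1 - c))) 0 z z0.
  - move=> x /[!in_itv]/= /andP[x0 xz]; apply: is_derive_lnT.
    by rewrite ger0_norm ?(ltW x0)// (le_trans _ z2)// ger0_norm// ltW.
  - apply: continuous_in_subspaceT => x /[!inE]/= /[!in_itv]/= /andP[x0 xz].
    by apply: continuous_at_lnT; rewrite ger0_norm// (le_trans _ z2)// ger0_norm.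
  rewrite in_itv/= => /andP[c0 cz]; rewrite lnT0 !subr0 => ->; apply: bd.
  by rewrite !ger0_norm.
have [||c] := @MVT_segment _ (lnT n) (fun c => - (c ^+ n / (1 - c))) z 0 (ltW z0).
- move=> x /[!in_itv]/= /andP[xz x0]; apply: is_derive_lnT.
  by rewrite (le_trans _ z2)// !ler0_norm ?lerN2 ?(ltW z0) ?(ltW xz) ?(ltW x0).
- apply: continuous_in_subspaceT => x /[!inE]/= /[!in_itv]/= /andP[xz x0].
  apply: continuous_at_lnT.
  by rewrite (le_trans _ z2)// !ler0_norm ?lerN2 ?(ltW z0) ?(ltW xz) ?(ltW x0).
rewrite in_itv/= => /andP[cz c0]; rewrite lnT0 !sub0r mulrN => /oppr_inj ->.
by apply: bd; rewrite !ler0_norm ?lerN2// ltW.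
Qed.

End LogSeries.

(** * Termwise integration of the logarithmic series *)

Section LogSeriesIntegral.
Context d {T : measurableType d} {R : realType}.
Variables (mu : {measure set T -> \bar R}) (D : set T).
Hypotheses (mD : measurable D) (muD : (mu D < +oo)%E).

Lemma bounded_Rintegrable (f : T -> R) (M : R) : measurable_fun D f ->
  (forall x, D x -> `|f x| <= M) -> mu.-integrable D (EFin \o f).
Proof.
move=> mf fM; apply: measurable_bounded_integrable => //.
exists M; split; rewrite ?num_real// => N MN x Dx /=.
by rewrite (le_trans (fM x Dx))// ltW.
Qed.

(** The uniform remainder integrates to at most [mu D * 2^-n], so no dominated convergence is
    needed. A general [h] allows expansions both at 0, with [h = s], and around a negative point,
    with [h = s / (1 - x0 s)]. *)
Lemma series_ln_integral (h : T -> R) (K y : R) : measurable_fun D h ->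
  (forall x, D x -> `|h x| <= K) -> `|y| * K <= 2^-1 ->
  series (fun k => (\int[mu]_(x in D) h x ^+ k.+1) / k.+1%:R * y ^+ k.+1) n
    @[n --> \oo] --> - \int[mu]_(x in D) ln (1 - y * h x).
Proof.
move=> mh hK yK.
have yh x : D x -> `|y * h x| <= 2^-1.
  by move=> Dx; rewrite normrM (le_trans _ yK)// ler_wpM2l// hK.
have ml : measurable_fun D (fun x => ln (1 - y * h x)).
  apply: measurableT_comp => //.
  by apply: measurable_funB => //; apply: measurable_funM.
have mp k : measurable_fun D (fun x => (y * h x) ^+ k.+1 / k.+1%:R).
  by apply: measurable_funM => //; apply: measurable_funX; apply: measurable_funM.
pose S n x := series (fun k => (y * h x) ^+ k.+1 / k.+1%:R) n.
have mS n : measurable_fun D (S n).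
  elim: n => [|n ih].
    by rewrite (_ : S 0 = cst 0)//; apply/funext => x; rewrite /S /series/= big_geq.
  rewrite (_ : S n.+1 = fun x => S n x + (y * h x) ^+ n.+1 / n.+1%:R).
    exact: measurable_funD.
  by apply/funext => x; rewrite /S seriesSr.
have ip k : mu.-integrable D (EFin \o (fun x => (y * h x) ^+ k.+1 / k.+1%:R)).
  apply: (bounded_Rintegrable (M := 1)) => // x Dx.
  have k1 : k.+1%:R^-1 <= 1 :> R by rewrite invf_le1// ler1n.
  have yh1 : `|y * h x| ^+ k.+1 <= 1.
    by rewrite exprn_ile1// (le_trans (yh x Dx))// invf_le1// ler1n.
  by rewrite normrM normrX [`|_^-1|]ger0_norm// mulr_ile1.
have il : mu.-integrable D (EFin \o (fun x => ln (1 - y * h x))).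
  apply: (bounded_Rintegrable (M := 1)) => // x Dx.
  have := ln1B_series_bound 0 (yh x Dx).
  by rewrite /series/= big_geq// addr0 expr0.
have iS n : mu.-integrable D (EFin \o S n).
  elim: n => [|n ih].
    rewrite (_ : S 0 = cst 0); first by apply: (bounded_Rintegrable (M := 0)) => // x _; rewrite normr0.
    by apply/funext => x; rewrite /S /series/= big_geq.
  rewrite (_ : _ \o _ = (EFin \o S n) \+ (EFin \o (fun x => ((y * h x) ^+ n.+1 / n.+1%:R)%R)))%E.
    exact: integrableD.
  by apply/funext => x; rewrite /= /S seriesSr.
have hk k : mu.-integrable D (EFin \o (fun x => h x ^+ k.+1)).
  apply: (bounded_Rintegrable (M := K ^+ k.+1)); first exact: measurable_funX.
  by move=> x Dx; rewrite normrX lerXn2r ?nnegrE// ?hK// (le_trans _ (hK x Dx)).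
have SE n : series (fun k => (\int[mu]_(x in D) h x ^+ k.+1) / k.+1%:R * y ^+ k.+1) n =
    \int[mu]_(x in D) S n x.
  elim: n => [|n ih].
    rewrite {1}/series/= big_geq// (_ : S 0 = cst 0) ?Rintegral_cst ?mul0r//.
    by apply/funext => x; rewrite /S /series/= big_geq.
  rewrite seriesSr ih.
  rewrite (@eq_Rintegral _ _ _ mu D (fun x => S n x + (y * h x) ^+ n.+1 / n.+1%:R) (S n.+1)); last first.
    by move=> x _; rewrite /S seriesSr.
  rewrite RintegralD//; congr +%R.
  rewrite -mulrA mulrC -RintegralZl//; apply: eq_Rintegral => x _.
  by rewrite exprMn; ring.
apply/cvgrPdist_le => /= e e0.
have g0 : (fine (mu D) * 2^-1 ^+ n) @[n --> \oo] --> fine (mu D) * 0.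
  by apply: cvgM; [exact: cvg_cst|apply: cvg_expr; rewrite ger0_norm//; lra].
move/cvgrPdist_le : g0 => /(_ e e0) /= g0.
near=> n; rewrite SE.
have : `|fine (mu D) * 0 - fine (mu D) * 2^-1 ^+ n| <= e by near: n.
rewrite mulr0 sub0r normrN ger0_norm; last first.
  by rewrite mulr_ge0// ?fine_ge0// exprn_ge0.
apply: le_trans; rewrite -opprD normrN -RintegralD//.
apply: (le_trans (le_normr_Rintegral _ _)) => //; first exact: integrableD (il) (iS n).
rewrite mulrC -Rintegral_cst//; apply: le_Rintegral => //.
- by apply: integrable_norm; exact: integrableD (il) (iS n).
- exact: (bounded_Rintegrable (M := `|2^-1 ^+ n|)) (fun x _ => lexx _).
- by move=> x Dx; exact: ln1B_series_bound (yh x Dx).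
Unshelve. all: by end_near. Qed.

End LogSeriesIntegral.

(** * The hexagon and its integrands *)

Section Hexagon.
Context {R : realType}.
Implicit Types (a b x y : R) (p : R * R).
Notation mu := (@lebesgue_measure R).
Notation mu2 := (mu \x mu)%E.

(* The squared modulus [|1 + e^(ia) + e^(ib)|^2], see [step2_sqr]. *)
Definition step2 a b : R := 3 + 2 * cos a + 2 * cos b + 2 * cos (a - b).

Lemma step2C a b : step2 a b = step2 b a.
Proof. by rewrite /step2 -(cosN (a - b)) opprB; ring. Qed.

Lemma step2_2piB a b : step2 (2 * pi - a) (2 * pi - b) = step2 a b.
Proof.
have cB t : cos (2 * pi - t) = cos t.
  by rewrite -[RHS]cosN -[RHS]cosD2pi; congr cos; rewrite mulr2n; ring.
rewrite /step2 !cB (_ : 2 * pi - a - _ = b - a); last by ring.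
by rewrite -(cosN (b - a)) opprB.
Qed.

Lemma step2_sqr a b : step2 a b = (1 + cos a + cos b) ^+ 2 + (sin a + sin b) ^+ 2.
Proof.
rewrite /step2 cosB; have Ea := sin2cos2 a; have Eb := sin2cos2 b.
by ring: Ea Eb.
Qed.

Lemma step2_ge0 a b : 0 <= step2 a b.
Proof. by rewrite step2_sqr addr_ge0 ?sqr_ge0. Qed.

Lemma step2_le9 a b : step2 a b <= 9.
Proof.
by rewrite /step2; have := cos_le1 a; have := cos_le1 b; have := cos_le1 (a - b); lra.
Qed.

(* The level set [step2 = 1] is a union of lines, so [step2 > 1] cuts out polygons. *)
Lemma step2_sub1 a b :
  step2 a b - 1 = 8 * (cos (a / 2) * cos (b / 2) * cos ((a - b) / 2)).
Proof.
have -> : step2 a b = step2 (a / 2 + a / 2) (b / 2 + b / 2) by rewrite -!splitr.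
have -> : (a - b) / 2 = a / 2 - b / 2 by field.
set x := a / 2; set y := b / 2.
rewrite /step2 (_ : x + x - (y + y) = (x - y) + (x - y)); last by ring.
rewrite (cosD x x) (cosD y y) (cosD (x - y)) (cosB x y) (sinB x y).
have Ex := sin2cos2 x; have Ey := sin2cos2 y.
by ring: Ex Ey.
Qed.

Let cosh_lt0 x : pi < x <= 2 * pi -> cos (x / 2) < 0.
Proof.
move=> /andP[x1 x2]; have pi0 := pi_gt0 R.
have := @cos_gt0_pihalf _ (x / 2 - pi).
rewrite -oppr_lt0 -[cos (_ - _)]opprK -cosDpi subrK opprK; apply.
by apply/andP; split; lra.
Qed.

Let cosh_gt0 x : - pi < x < pi -> 0 < cos (x / 2).
Proof.
move=> /andP[x1 x2]; have pi0 := pi_gt0 R.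
by apply: cos_gt0_pihalf; apply/andP; split; lra.
Qed.

(** The square [[0, 2 pi]^2] cuts the hexagon along its edges, so a vertical section is a union of
    two intervals. The factor [cos (a / 2)] is positive here; the signs of the two other cosines
    decide. *)
Lemma step2_gt1_lt a b : 0 <= a < pi -> 0 <= b <= 2 * pi ->
  (1 < step2 a b) = (b < pi) || (a + pi < b).
Proof.
move=> /andP[a0 api] /andP[b0 b2]; have pi0 := pi_gt0 R.
rewrite -subr_gt0 step2_sub1 pmulr_rgt0// -mulrA pmulr_rgt0; last first.
  by apply: cosh_gt0; lra.
have ab : cos ((a - b) / 2) = cos ((b - a) / 2).
  by rewrite -cosN -mulNr opprB.
have [bpi|bpi|->] /= := ltgtP b pi.
- by rewrite mulr_gt0// cosh_gt0//; lra.
- have b2lt : cos (b / 2) < 0 by apply: cosh_lt0; lra.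
  rewrite nmulr_rgt0// ab; apply/idP/idP => [|h]; last by apply: cosh_lt0; lra.
  have [//|h|h] := ltgtP (a + pi) b.
    by rewrite ltNge ltW// cosh_gt0//; lra.
  by rewrite -h addrAC subrr add0r cos_pihalf ltxx.
- by rewrite cos_pihalf mul0r ltxx; apply/esym/negbTE; rewrite -leNgt; lra.
Qed.

Lemma step2_gt1_gt a b : pi < a <= 2 * pi -> 0 <= b <= 2 * pi ->
  (1 < step2 a b) = (b < a - pi) || (pi < b).
Proof.
move=> /andP[a0 api] /andP[b0 b2]; have pi0 := pi_gt0 R.
rewrite -step2_2piB step2_gt1_lt; [|apply/andP; split; lra..].
by rewrite orbC; congr (_ || _); apply/idP/idP => ?; lra.
Qed.

(** An algebra of functions that are integrable on the hexagon because it has finite measure. The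
    closure lemmas below reduce integrability of a trigonometric polynomial to its syntax. *)
Definition bounded_measurable (f : R * R -> R) :=
  measurable_fun setT f /\ exists M, forall p, `|f p| <= M.

Lemma bounded_measurable_cst (c : R) : bounded_measurable (fun=> c).
Proof. by split; [exact: measurable_cst|exists `|c|]. Qed.

Lemma bounded_measurableD f g : bounded_measurable f -> bounded_measurable g ->
  bounded_measurable (fun p => f p + g p).
Proof.
move=> [mf [M fM]] [mg [N gN]]; split; first exact: measurable_funD.
by exists (M + N) => p; rewrite (le_trans (ler_normD _ _))// lerD.
Qed.

Lemma bounded_measurableN f : bounded_measurable f ->
  bounded_measurable (fun p => - f p).
Proof.
by move=> [mf [M fM]]; split; [exact: measurable_funN|exists M => p; rewrite normrN].
Qed.

Lemma bounded_measurableM f g : bounded_measurable f -> bounded_measurable g ->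
  bounded_measurable (fun p => f p * g p).
Proof.
move=> [mf [M fM]] [mg [N gN]]; split; first exact: measurable_funM.
by exists (M * N) => p; rewrite normrM ler_pM.
Qed.

Lemma bounded_measurableX f n : bounded_measurable f ->
  bounded_measurable (fun p => f p ^+ n).
Proof.
move=> [mf [M fM]]; split; first exact: measurable_funX.
exists (M ^+ n) => p; rewrite normrX lerXn2r ?nnegrE//.
exact: le_trans (fM p).
Qed.

Lemma bounded_measurable_cos f : measurable_fun setT f ->
  bounded_measurable (fun p => cos (f p)).
Proof.
move=> mf; split; last by exists 1 => p; exact: cos_max.
by apply: measurableT_comp mf; apply: continuous_measurable_fun; exact: continuous_cos.
Qed.

Lemma bounded_measurable_sin f : measurable_fun setT f ->
  bounded_measurable (fun p => sin (f p)).
Proof.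
move=> mf; split; last by exists 1 => p; exact: sin_max.
by apply: measurableT_comp mf; apply: continuous_measurable_fun; exact: continuous_sin.
Qed.

Lemma bounded_measurable_step2 : bounded_measurable (fun p => step2 p.1 p.2).
Proof.
do 3?[apply: bounded_measurableD]; [exact: bounded_measurable_cst|..];
  apply: bounded_measurableM; try exact: bounded_measurable_cst;
  apply: bounded_measurable_cos => //.
exact: measurable_funB.
Qed.

(* Modulo [2 * pi], this is the hexagon [|a|, |b|, |a - b| < pi]. *)
Definition hexagon : set (R * R) :=
  (@I02pi R `*` @I02pi R) `&` [set p | 1 < step2 p.1 p.2].

Lemma measurable_hexagon : measurable hexagon.
Proof.
apply: measurableI; first by apply: measurableX; exact: measurable_itv.
rewrite (_ : [set _ | _] = (fun p => step2 p.1 p.2) @^-1` `]1, +oo[).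
  by rewrite -[X in measurable X]setTI; apply: bounded_measurable_step2.1.
by apply/seteqP; split => p /=; rewrite in_itv/= andbT.
Qed.

Lemma mu2_hexagon : (mu2 hexagon < +oo)%E.
Proof.
apply: (@le_lt_trans _ _ (mu2 (@I02pi R `*` @I02pi R))).
  apply: le_measure; rewrite ?inE; [exact: measurable_hexagon|by apply: measurableX; exact: measurable_itv|].
  by move=> p [].
rewrite product_measure1E//; try exact: measurable_itv.
rewrite /= /I02pi lebesgue_measure_itv/=; case: ifPn => _; [by rewrite -EFinB -EFinM ltry|by rewrite mule0 ltry].
Qed.

End Hexagon.

(** * Iterated integrals over the hexagon *)

Section HexagonFubini.
Context {R : realType}.
Implicit Types (a b x y : R) (p : R * R).
Notation mu := (@lebesgue_measure R).
Notation mu2 := (mu \x mu)%E.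
Notation hexagon := (@hexagon R).

Let measurable_xhex a : measurable (xsection hexagon a).
Proof. by apply: measurable_xsection; exact: measurable_hexagon. Qed.

Let xhex_sub a : xsection hexagon a `<=` `[0, 2 * pi].
Proof. by move=> b; rewrite /xsection/= inE => -[[]]. Qed.

Lemma bounded_integrable_hexagon q : bounded_measurable q ->
  mu2.-integrable hexagon (EFin \o q).
Proof.
move=> [mq [M qM]]; apply: (bounded_Rintegrable _ _ (M := M)) => //.
- exact: measurable_hexagon.
- exact: mu2_hexagon.
- exact: measurable_funTS.
Qed.

Let integrable_restrict_hexagon q : bounded_measurable q ->
  mu2.-integrable setT (EFin \o (q \_ hexagon)).
Proof.
move=> bq; rewrite -restrict_EFin.
exact: ((integrable_mkcond (mu := mu2) (EFin \o q) (@measurable_hexagon R)).1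
  (bounded_integrable_hexagon bq)).
Qed.

Let section_integrable q a : bounded_measurable q ->
  mu.-integrable (xsection hexagon a) (EFin \o (fun b => q (a, b))).
Proof.
move=> [mq [M qM]]; apply: (bounded_Rintegrable _ _ (M := M)) => //.
- exact: measurable_xhex.
- apply: (@le_lt_trans _ _ (mu `[0, 2 * pi])); last first.
    by rewrite lebesgue_measure_itv/=; case: ifPn => _; rewrite -?EFinB ltry.
  by apply: le_measure; rewrite ?inE; [exact: measurable_xhex|exact: measurable_itv|].
- by apply: measurable_funTS; exact: measurableT_comp mq _.
Qed.

Let fubini_F_hexagon q : bounded_measurable q ->
  (fun a => \int[mu]_b ((q \_ hexagon) (a, b))%:E)%E =
  EFin \o (fun a => \int[mu]_(b in xsection hexagon a) q (a, b)).
Proof.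
move=> bq; apply/funext => a /=.
rewrite /Rintegral fineK; last first.
  by apply: integrable_fin_num; first [exact: measurable_xhex|exact: section_integrable].
rewrite [RHS]integral_mkcond; apply: eq_integral => b _.
by rewrite !patchE mem_xsection; case: ifPn.
Qed.

Lemma Rintegral_hexagon q : bounded_measurable q ->
  let G a := \int[mu]_(b in xsection hexagon a) q (a, b) in
  mu.-integrable `[0, 2 * pi] (EFin \o G) /\
  \int[mu2]_(p in hexagon) q p = \int[mu]_(a in `[0, 2 * pi]) G a.
Proof.
move=> bq G; have ihex := integrable_restrict_hexagon bq.
have := integrable_fubini_F ihex; have := integral12_prod_meas1 ihex.
rewrite /fubini_F /= (fubini_F_hexagon bq) -/G => EG iG; split.
  by apply: integrableS iG.
rewrite [LHS]Rintegral_mkcond [RHS]Rintegral_mkcond.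
apply: (congr1 fine (etrans (esym EG) _)).
apply: eq_integral => a _; rewrite patchE; case: ifPn => //= aI.
rewrite /G (_ : xsection _ _ = set0) ?Rintegral_set0// -subset0 => b.
by rewrite /xsection/= inE => -[[/= aI' _]] _; move: aI; rewrite notin_setE.
Qed.

(** The hexagon is symmetric, so the two orders of integration can be compared. This lets the
    [b]-component of a symmetric field account for its [a]-component too. *)
Lemma Rintegral_hexagon_swap q : bounded_measurable q ->
  bounded_measurable (fun p => q (p.2, p.1)) ->
  \int[mu2]_(p in hexagon) q (p.2, p.1) = \int[mu2]_(p in hexagon) q p.
Proof.
move=> bq bq'; rewrite Rintegral_mkcond [RHS]Rintegral_mkcond /Rintegral.
have := integral12_prod_meas1 (integrable_restrict_hexagon bq).
have := integral21_prod_meas1 (integrable_restrict_hexagon bq').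
rewrite /fubini_F /fubini_G => <- <-; congr fine.
apply: eq_integral => a _; apply: eq_integral => b _ /=; rewrite !patchE/=.
suff -> : ((b, a) \in hexagon) = ((a, b) \in hexagon) by [].
by apply/idP/idP; rewrite !inE => -[[/= h1 h2]] /= h3; split; rewrite //= step2C.
Qed.

Let xhex_lt a : 0 <= a < pi ->
  xsection hexagon a = `[0, pi[ `|` `]a + pi, 2 * pi].
Proof.
move=> a01; have pi0 := pi_gt0 R; apply/seteqP; split => b.
  rewrite /xsection/= inE => -[[_ /=]]; rewrite /I02pi/= in_itv/= => b01.
  by rewrite step2_gt1_lt// => /orP[]h; [left|right]; rewrite /= in_itv/=; lra.
move=> bU; have b01 : 0 <= b <= 2 * pi.
  by move: bU => []/=; rewrite in_itv/=; lra.
rewrite /xsection/= inE; split; first by split; rewrite /I02pi/= in_itv/=; lra.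
rewrite /= step2_gt1_lt//.
by move: bU => []/=; rewrite in_itv/=; lra.
Qed.

Let xhex_gt a : pi < a <= 2 * pi ->
  xsection hexagon a = `[0, a - pi[ `|` `]pi, 2 * pi].
Proof.
move=> a01; have pi0 := pi_gt0 R; apply/seteqP; split => b.
  rewrite /xsection/= inE => -[[_ /=]]; rewrite /I02pi/= in_itv/= => b01.
  by rewrite step2_gt1_gt// => /orP[]h; [left|right]; rewrite /= in_itv/=; lra.
move=> bU; have b01 : 0 <= b <= 2 * pi.
  by move: bU => []/=; rewrite in_itv/=; lra.
rewrite /xsection/= inE; split; first by split; rewrite /I02pi/= in_itv/=; lra.
rewrite /= step2_gt1_gt//.
by move: bU => []/=; rewrite in_itv/=; lra.
Qed.

Let Rintegral_two_itv (q V : R -> R) x y z w : x <= y -> y <= z -> z <= w ->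
  continuous q -> (forall b, is_derive b 1 V (q b)) ->
  \int[mu]_(b in `[x, y[ `|` `]z, w]) q b = V y - V x + (V w - V z).
Proof.
move=> xy yz zw cq dV; have iq s t : mu.-integrable `[s, t] (EFin \o q).
  exact: continuous_itv_integrable.
have s1 : `[x, y[ `<=` `[x, w].
  by move=> t /=; rewrite !in_itv/= => /andP[-> ty]; rewrite ltW// (lt_le_trans ty)// (le_trans yz).
have s2 : `]z, w] `<=` `[x, w].
  by move=> t /=; rewrite !in_itv/= => /andP[zt ->]; rewrite andbT (le_trans xy)// (le_trans yz)// ltW.
rewrite Rintegral_setU//; first last.
- apply/disj_setPS => t [] /=; rewrite !in_itv/= => /andP[_ ty] /andP[zt _].
  by move: (lt_trans ty (le_lt_trans yz zt)); rewrite ltxx.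
- by apply: integrableS (iq x w); [|exact: measurableU|rewrite subUset; split].
rewrite Rintegral_itv_bndo_bndc; last by apply: integrableS (iq x w).
rewrite Rintegral_itv_obnd_cbnd; last by apply: integrableS (iq x w).
by congr +%R; apply: Rintegral_is_derive.
Qed.

(** Green's formula in the direction of [b]: [w1] and [w2] collect the values of [V] at the ends of
    the two intervals of a section, for [a < pi] and [a > pi], and [W1], [W2] integrate them over
    [a]. *)
Lemma Rintegral_hexagon_primitive (q V : R -> R -> R) (W1 W2 w1 w2 : R -> R) :
  bounded_measurable (fun p => q p.1 p.2) ->
  (forall a, continuous (q a)) ->
  (forall a b, is_derive b 1 (V a) (q a b)) ->
  continuous w1 -> (forall a, is_derive a 1 W1 (w1 a)) ->
  continuous w2 -> (forall a, is_derive a 1 W2 (w2 a)) ->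
  (forall a, w1 a = V a pi - V a 0 + (V a (2 * pi) - V a (a + pi))) ->
  (forall a, w2 a = V a (a - pi) - V a 0 + (V a (2 * pi) - V a pi)) ->
  \int[mu2]_(p in hexagon) q p.1 p.2 = W1 pi - W1 0 + (W2 (2 * pi) - W2 pi).
Proof.
move=> bq cq dV cw1 dW1 cw2 dW2 w1E w2E; have pi0 := pi_gt0 R.
have [] := Rintegral_hexagon bq; set G := (fun a : R => _) => iG -> /=.
have G1 a : 0 <= a < pi -> G a = w1 a.
  move=> a01; rewrite /G xhex_lt// w1E.
  by apply: (@Rintegral_two_itv (q a) (V a)) => //; lra.
have G2 a : pi < a <= 2 * pi -> G a = w2 a.
  move=> a01; rewrite /G xhex_gt// w2E.
  by apply: (@Rintegral_two_itv (q a) (V a)) => //; lra.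
have iGs A : measurable A -> A `<=` `[0, 2 * pi] -> mu.-integrable A (EFin \o G).
  by move=> mA AI; apply: integrableS iG.
have sub1 : (`[0, pi[ : set R) `<=` `[0, 2 * pi].
  by move=> t /=; rewrite !in_itv/=; lra.
have sub2 : (`]pi, 2 * pi] : set R) `<=` `[0, 2 * pi].
  by move=> t /=; rewrite !in_itv/=; lra.
have -> : `[0, 2 * pi] = `[0, pi[ `|` `[pi, 2 * pi] :> set R.
  by apply/seteqP; split=> t /=; rewrite !in_itv/=; [case: (ltP t pi); [left|right]; lra|case; lra].
have sub3 : (`[pi, 2 * pi] : set R) `<=` `[0, 2 * pi].
  by move=> t /=; rewrite !in_itv/=; lra.
rewrite Rintegral_setU//; first last.
- by apply/disj_setPS => t [] /=; rewrite !in_itv/=; lra.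
- by apply: iGs; [exact: measurableU|rewrite subUset; split].
(* Neither description of the section covers [a = pi]; this single point is dropped. *)
have -> : \int[mu]_(a in `[pi, 2 * pi]) G a = \int[mu]_(a in `]pi, 2 * pi]) G a.
  by rewrite Rintegral_itv_obnd_cbnd//; exact: iGs.
rewrite (@eq_Rintegral _ _ _ mu `[0, pi[ w1 G); last first.
  by move=> a; rewrite inE/= in_itv/= => a01; exact: G1.
rewrite (@eq_Rintegral _ _ _ mu `]pi, 2 * pi] w2 G); last first.
  by move=> a; rewrite inE/= in_itv/= => a01; exact: G2.
have iw1 : mu.-integrable `[0, 2 * pi] (EFin \o w1) by exact: continuous_itv_integrable.
have iw2 : mu.-integrable `[0, 2 * pi] (EFin \o w2) by exact: continuous_itv_integrable.
rewrite Rintegral_itv_bndo_bndc; last exact: integrableS iw1.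
rewrite Rintegral_itv_obnd_cbnd; last exact: integrableS iw2.
congr +%R.
- by apply: Rintegral_is_derive => //; exact: ltW.
- by apply: Rintegral_is_derive => //; lra.
Qed.

End HexagonFubini.

(** * The recurrence of the moments *)

Section Moments.
Context {R : realType}.
Implicit Types (a b : R) (k n : nat).
Notation mu := (@lebesgue_measure R).
Notation mu2 := (mu \x mu)%E.
Notation hexagon := (@hexagon R).

(* [B] and [A] were found by solving a linear system for trigonometric polynomials making
   [divV] below hold; [Sb], [Bb], [Ab] are derivatives with respect to [b]. *)
Let S a b : R := step2 a b.
Let Sb a b : R := - (2 * sin b) + 2 * sin (a - b).
Let B a b : R := 2 * sin b + sin (b - a).
Let Bb a b : R := 2 * cos b + cos (b - a).
Let A a b : R := 6 * sin a + sin (b - a - a) + 4 * sin (b - a) + 11 * sin b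
  + 6 * sin (a + b) + sin (b - a + (b - a)) + 4 * sin (b + (b - a)) + 2 * sin (b + b).
Let Ab a b : R := cos (b - a - a) + 4 * cos (b - a) + 11 * cos b
  + 6 * cos (a + b) + 2 * cos (b - a + (b - a)) + 8 * cos (b + (b - a)) + 4 * cos (b + b).

Let is_derive_S a b : is_derive b 1 (S a) (Sb a b).
Proof. by apply: is_derive_eq; rewrite /GRing.scale/= /Sb; ring. Qed.

Let is_derive_B a b : is_derive b 1 (B a) (Bb a b).
Proof. by apply: is_derive_eq; rewrite /GRing.scale/= /Bb; ring. Qed.

Let is_derive_A a b : is_derive b 1 (A a) (Ab a b).
Proof. by apply: is_derive_eq; rewrite /GRing.scale/= /Ab; ring. Qed.

Let trig := (@sinD R, @cosD R, @sinN R, @cosN R).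

(** The divergence of the field built from [S^k B + k S^(k-1) A] expands in 1, [k] and [k (k - 1)].
    Comparing with the recurrence gives three conditions: this one and the next two. *)
Let divB a b : Bb a b + Bb b a = S a b - 3.
Proof. by rewrite /Bb /S /step2 !trig; ring. Qed.

(** Here [(S - 1) (S - 9)] mirrors the coefficient [1 - 10 t + 9 t^2] of [theta^2] in L_2 under
    [t = 1/S]. Vanishing at [S = 1] says that the field of [A] is tangent to the sides of the
    hexagon, so it carries no flux. *)
Let gradS_A a b : Sb a b * A a b + Sb b a * A b a = S a b * ((S a b - 1) * (S a b - 9)).
Proof.
rewrite /Sb /A /S /step2 !trig; have Ea := sin2cos2 a; have Eb := sin2cos2 b.
by ring: Ea Eb.
Qed.

Let gradS_B_divA a b : Sb a b * B a b + Sb b a * B b a + (Ab a b + Ab b a) =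
  3 * S a b ^+ 2 - 20 * S a b + 9.
Proof.
rewrite /Sb /B /Ab /S /step2 !trig; have Ea := sin2cos2 a; have Eb := sin2cos2 b.
by ring: Ea Eb.
Qed.

(** The recurrence is quadratic in [k] and differentiating a power of [S] yields one factor [k], so
    a field linear in [k] suffices. The truncated [k.-1] at [k = 0] is multiplied by [k]. *)
Let V k a b : R := S a b ^+ k * B a b + k%:R * (S a b ^+ k.-1 * A a b).
Let q k a b : R := S a b ^+ k * Bb a b + B a b * (k%:R * S a b ^+ k.-1 * Sb a b)
  + k%:R * (S a b ^+ k.-1 * Ab a b
            + A a b * (k.-1%:R * S a b ^+ k.-1.-1 * Sb a b)).

Let is_derive_V k a b : is_derive b 1 (V k a) (q k a b).
Proof.
have -> : V k a = (S a ^+ k * B a) + k%:R \*: (S a ^+ k.-1 * A a).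
  by apply/funext => t; rewrite /V /GRing.scale/= !exprfctE.
apply: is_derive_eq; rewrite /GRing.scale/= !exprfctE /q /Bb /Ab /Sb.
by ring.
Qed.

(* The left-hand side is the divergence at [(a, b)] of the field [(V k b a, V k a b)]. *)
Let divV k a b : q k a b + q k b a =
  (k.+1)%:R ^+ 2 * S a b ^+ k.+1 - (10 * k%:R ^+ 2 + 10 * k%:R + 3) * S a b ^+ k
  + 9 * k%:R ^+ 2 * S a b ^+ k.-1.
Proof.
have SC : S b a = S a b by exact: step2C.
rewrite /q SC; case: k => [|m].
  by rewrite !mul0r !mulr0 !addr0 !expr0 !mul1r divB; ring.
rewrite [m.+1.-1]/= -!natr1; set s := S a b; set M := m%:R.
have -> : s ^+ m.+2 = s * s * s ^+ m by rewrite !exprS mulrA.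
have -> : s ^+ m.+1 = s * s ^+ m by rewrite exprS.
(* For [m = 0] the predecessor is truncated, and the factor [M] makes both sides 0. *)
have Es : M * s ^+ m.-1 * s = M * s ^+ m.
  by rewrite /M; case: m @M => [|m] M; rewrite ?mul0r// -mulrA -exprSr.
have EA := gradS_A a b; have EBA := gradS_B_divA a b; have EB := divB a b.
rewrite -/s in EA EBA EB.
transitivity (s * s ^+ m * (Bb a b + Bb b a)
   + (M + 1) * s ^+ m * (Sb a b * B a b + Sb b a * B b a + (Ab a b + Ab b a))
   + (M + 1) * (M * s ^+ m.-1 * (Sb a b * A a b + Sb b a * A b a))); first by ring.
rewrite EA EBA EB [_ * (s * _)]mulrA Es; ring.
Qed.


Let continuous_deriv (f g : R -> R) : (forall x : R, is_derive x 1 f (g x)) -> continuous f.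
Proof. by move=> df x; have [/derivable1_diffP/differentiable_continuous] := df x. Qed.

Let continuousS a : continuous (S a). Proof. exact: continuous_deriv (is_derive_S a). Qed.

Let continuous_q k a : continuous (q k a).
Proof.
have cS n : continuous (fun b => S a b ^+ n).
  by move=> b; apply: (@continuous_comp _ _ _ (S a) (fun x => x ^+ n));
    [exact: continuousS|exact: exprn_continuous].
have cB := continuous_deriv (is_derive_B a); have cA := continuous_deriv (is_derive_A a).
have cSb : continuous (Sb a).
  have dSb b : is_derive b 1 (Sb a) (- (2 * cos b) - 2 * cos (a - b)).
    by apply: is_derive_eq; rewrite /GRing.scale/=; ring.
  exact: continuous_deriv dSb.
have cBb : continuous (Bb a).
  have dBb b : is_derive b 1 (Bb a) (- (2 * sin b) - sin (b - a)).
    by apply: is_derive_eq; rewrite /GRing.scale/=; ring.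
  exact: continuous_deriv dBb.
have cAb : continuous (Ab a).
  have dAb b : is_derive b 1 (Ab a) ('D_1 (Ab a) b) by exact: derivableP.
  exact: continuous_deriv dAb.
move=> b; apply: cvgD; first apply: cvgD.
- by apply: cvgM; [exact: cS|exact: cBb].
- apply: cvgM; first exact: cB.
  by apply: cvgM; [apply: cvgM; [exact: cvg_cst|exact: cS]|exact: cSb].
- apply: cvgM; first exact: cvg_cst.
  apply: cvgD; first by apply: cvgM; [exact: cS|exact: cAb].
  apply: cvgM; first exact: cA.
  by apply: cvgM; [apply: cvgM; [exact: cvg_cst|exact: cS]|exact: cSb].
Qed.

Let bounded_measurable_q k : bounded_measurable (fun p : R * R => q k p.1 p.2).
Proof.
rewrite /q /Bb /Ab /B /A /Sb /S.
repeat first [exact: bounded_measurable_cst | exact: bounded_measurable_step2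
  | exact: (bounded_measurableX _ bounded_measurable_step2)
  | apply: bounded_measurableD | apply: bounded_measurableM
  | apply: bounded_measurableN
  | apply: bounded_measurable_cos | apply: bounded_measurable_sin
  | exact: measurable_fst | exact: measurable_snd
  | apply: measurable_funB | apply: measurable_funD ].
Qed.

Let bounded_measurable_swap (f : R * R -> R) : bounded_measurable f ->
  bounded_measurable (fun p => f (p.2, p.1)).
Proof.
move=> [mf [M fM]]; split; last by exists M.
by apply: measurableT_comp mf _; exact: measurable_swap.
Qed.

Let S_pi a : S a pi = 1.
Proof. by rewrite /S /step2 cosB cospi sinpi; ring. Qed.

Let S_Dpi a : S a (a + pi) = 1.
Proof.
by rewrite /S /step2 (_ : a - (a + pi) = - pi) ?cosN ?cosDpi ?cospi; ring.
Qed.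

Let V_pi k a : V k a pi = sin a.
Proof.
rewrite /V S_pi !expr1n /A /B; move: (@cospi R) (@sinpi R); move: (pi) => x cx sx.
rewrite !trig cx sx; have Ea := sin2cos2 a.
ring: Ea.
Qed.

Let V_Dpi k a : V k a (a + pi) = - (2 * sin a) - 8 * k%:R * (sin a * cos a).
Proof.
rewrite /V S_Dpi !expr1n /A /B; move: (@cospi R) (@sinpi R); move: (pi) => x cx sx.
rewrite !trig cx sx; have Ea := sin2cos2 a.
ring: Ea.
Qed.

Let V_D2pi k a b : V k a (b + 2 * pi) = V k a b.
Proof.
have c2 : cos (2 * pi) = 1 :> R by rewrite mulr_natl cos2pi.
have s2 : sin (2 * pi) = 0 :> R by rewrite mulr_natl sin2pi.
move: c2 s2; move: (2 * pi) => x c2 s2; rewrite /V /S /A /B /step2 !trig c2 s2.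
by rewrite !(mulr1, mulr0, addr0, subr0, add0r).
Qed.

Let Rintegral_q k : \int[mu2]_(p in hexagon) q k p.1 p.2 = 12.
Proof.
(* By periodicity the values at [b = 0] and [b = 2 pi] cancel, leaving [w = V a pi - V a (a + pi)]
   for [a < pi] and its opposite for [a > pi]. The [k]-term of [W] contains [sin^2] and vanishes at
   0, [pi] and [2 pi], so only [3 sin a] contributes: 6 from each half. *)
pose w a : R := 3 * sin a + 8 * k%:R * (sin a * cos a).
pose W a : R := - (3 * cos a) + 4 * k%:R * (sin a * sin a).
have dW a : is_derive a 1 W (w a).
  by apply: is_derive_eq; rewrite /GRing.scale/= /w; ring.
have dNW a : is_derive a 1 (\- W) (- w a) by apply: is_deriveN.
have cw : continuous w.
  have dw b : is_derive b 1 w ('D_1 w b) by exact: derivableP.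
  exact: continuous_deriv dw.
transitivity (W pi - W 0 + ((\- W) (2 * pi) - (\- W) pi)).
  apply: (@Rintegral_hexagon_primitive _ (q k) (V k) W (\- W) w (\- w)) => //.
  - by move=> a; apply: cvgN; exact: cw.
  - by move=> a; rewrite V_pi V_Dpi -[2 * pi]add0r V_D2pi /w; ring.
  - move=> a; have := V_D2pi k a (a - pi).
    rewrite (_ : a - pi + _ = a + pi); last by ring.
    by move=> <-; rewrite V_pi V_Dpi -[2 * pi]add0r V_D2pi /w /=; ring.
have c2 : cos (2 * pi) = 1 :> R by rewrite mulr_natl cos2pi.
have s2 : sin (2 * pi) = 0 :> R by rewrite mulr_natl sin2pi.
by rewrite /W /= sinpi cospi cos0 sin0 c2 s2; ring.
Qed.

Definition hexagon_moment n : R := \int[mu2]_(p in hexagon) step2 p.1 p.2 ^+ n.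

Let integrable_step2X n :
  mu2.-integrable hexagon (EFin \o (fun p => step2 p.1 p.2 ^+ n)).
Proof.
apply: bounded_integrable_hexagon.
exact: bounded_measurableX bounded_measurable_step2.
Qed.

(** Integrating [divV]: both components of the field contribute 12 by symmetry. *)
Lemma hexagon_moment_rec k :
  (k.+1)%:R ^+ 2 * hexagon_moment k.+1
  - (10 * k%:R ^+ 2 + 10 * k%:R + 3) * hexagon_moment k
  + 9 * k%:R ^+ 2 * hexagon_moment k.-1 = 24.
Proof.
have mh := @measurable_hexagon R.
have iZ c n : mu2.-integrable hexagon (EFin \o (fun p => c * step2 p.1 p.2 ^+ n)).
  apply: bounded_integrable_hexagon; apply: bounded_measurableM.
    exact: bounded_measurable_cst.
  exact: bounded_measurableX bounded_measurable_step2.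
rewrite /hexagon_moment -!RintegralZl// -RintegralB//.
rewrite -RintegralD//; last first.
  apply: bounded_integrable_hexagon; apply: bounded_measurableD.
    apply: bounded_measurableM; first exact: bounded_measurable_cst.
    exact: bounded_measurableX bounded_measurable_step2.
  apply: bounded_measurableN; apply: bounded_measurableM.
    exact: bounded_measurable_cst.
  exact: bounded_measurableX bounded_measurable_step2.
transitivity (\int[mu2]_(p in hexagon) (q k p.1 p.2 + q k p.2 p.1)).
  by apply: eq_Rintegral => p _; rewrite divV.
have bq := bounded_measurable_q k; have bq' := bounded_measurable_swap bq.
rewrite RintegralD//; try exact: bounded_integrable_hexagon.
by rewrite (Rintegral_hexagon_swap bq bq') Rintegral_q; ring.
Qed.

Lemma hexagon_moment0 : hexagon_moment 0 = 3 * pi ^+ 2.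
Proof.
(* Primitives of the section lengths, [2 pi - a] for [a < pi] and [a] for [a > pi]. *)
pose W1 a : R := 2 * pi * a - a * a / 2; pose W2 a : R := a * a / 2.
have dW1 a : is_derive a 1 W1 (2 * pi - a).
  by apply: is_derive_eq; rewrite /GRing.scale/=; field.
have dW2 a : is_derive a 1 W2 a.
  by apply: is_derive_eq; rewrite /GRing.scale/=; field.
have c1 : continuous (fun a : R => 2 * pi - a).
  by move=> a; apply: cvgB; [exact: cvg_cst|exact: cvg_id].
have c2 : continuous (fun a : R => a) by move=> a; exact: cvg_id.
transitivity (\int[mu2]_(p in hexagon) (fun _ _ : R => 1 : R) p.1 p.2).
  by apply: eq_Rintegral => p _; rewrite expr0.
transitivity (W1 pi - W1 0 + (W2 (2 * pi) - W2 pi)); last by rewrite /W1 /W2; field.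
apply: (@Rintegral_hexagon_primitive _ (fun _ _ => 1) (fun _ b => b)
  W1 W2 (fun a => 2 * pi - a) (fun a => a)) => //.
- exact: bounded_measurable_cst.
- by move=> a b; exact: cvg_cst.
- by move=> a; ring.
- by move=> a; ring.
Qed.

End Moments.

(* The library's canonical [SigmaFiniteMeasure] on [\x] only covers subprobabilities, hence this alias. *)
Definition plane_measure (R : realType) :
    set (measurableTypeR R * measurableTypeR R) -> \bar R :=
  (@lebesgue_measure R \x @lebesgue_measure R)%E.

HB.instance Definition _ (R : realType) := Measure.on (@plane_measure R).

Lemma plane_measure_sigma_finite (R : realType) : sigma_finite setT (@plane_measure R).
Proof.
pose J n : set R := `[- n%:R, n%:R].
have mJ n : measurable (J n) by exact: measurable_itv.
exists (fun n => J n `*` J n).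
  apply/esym; rewrite -subTset => -[x y] _.
  have [n xyn] : exists n, `|x| + `|y| <= n%:R.
    by exists (Num.bound (`|x| + `|y|)); apply/ltW/archi_boundP; rewrite addr_ge0.
  have x0 := normr_ge0 x; have y0 := normr_ge0 y.
  by exists n => //; split; rewrite /J/= in_itv/= -ler_norml; lra.
move=> n; split; first by apply: measurableX; exact: mJ.
rewrite /plane_measure product_measure1E; [|exact: mJ|exact: mJ].
by rewrite /= /J lebesgue_measure_itv/=; case: ifPn => _; rewrite ?mule0 -?EFinB -?EFinM ltry.
Qed.

HB.instance Definition _ (R : realType) := Measure_isSigmaFinite.Build _ _ _
  (@plane_measure R) (@plane_measure_sigma_finite R).

(** * The Mahler measure as an integral over the hexagon *)

Section MahlerMeasure.
Context {R : realType}.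
Implicit Types (a b c x y : R) (p : R * R).
Notation mu := (@lebesgue_measure R).
Notation mu2 := (mu \x mu)%E.
Notation mu3 := (@plane_measure R \x mu)%E.
Notation hexagon := (@hexagon R).
Notation I := (@I02pi R).

Let Q a b c : R :=
  (1 + cos a + cos b + cos c) ^+ 2 + (sin a + sin b + sin c) ^+ 2.

(** On the torus inversion is conjugation, so the second factor of [P3] is the conjugate of the
    first. *)
Lemma normc_P3 a b c : Normc.normc (P3 (expi a) (expi b) (expi c)) = Q a b c.
Proof.
have expiV t : (expi t : R[i])^-1 = (cos t -i* sin t)%C.
  by rewrite /expi /GRing.inv/= cos2Dsin2 !divr1.
rewrite /P3 !expiV Normc.normcM /expi /Normc.normc /=.
have E : 0 + - sin a + - sin b + - sin c = - (0 + sin a + sin b + sin c) by ring.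
by rewrite E sqrrN -expr2 sqr_sqrtr ?addr_ge0 ?sqr_ge0// add0r.
Qed.

Lemma Rintegral_ln_norm a b : step2 a b != 1 ->
  \int[mu]_(c in I) ln (Q a b c) = 2 * pi * ln (Num.max (step2 a b) 1).
Proof. by rewrite step2_sqr => S1; exact: jensen_circle. Qed.

Let N : set (R * R) := (I `*` I) `&` [set p | step2 p.1 p.2 = 1].

Let measurable_level1 : measurable [set p : R * R | step2 p.1 p.2 = 1].
Proof.
rewrite (_ : [set _ | _] = (fun p : R * R => step2 p.1 p.2) @^-1` [set 1]).
  by rewrite -[X in measurable X]setTI; apply: bounded_measurable_step2.1.
by apply/seteqP; split.
Qed.

Let measurable_N : measurable N.
Proof.
by apply: measurableI => //; apply: measurableX; exact: measurable_itv.
Qed.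

Let cos_half_eq0 x : - (2 * pi) <= x <= 2 * pi -> cos (x / 2) = 0 ->
  x = pi \/ x = - pi.
Proof.
rewrite -ler_norml => x2; have pi0 := pi_gt0 R.
have -> : cos (x / 2) = cos (`|x| / 2).
  by rewrite -[LHS]cos_norm normrM [`|2^-1|]ger0_norm.
move=> cx; suff xpi : `|x| = pi.
  by move: xpi; case: (ger0P x) => _ <-; [left|right; rewrite opprK].
have x0 := normr_ge0 x; have [xpi|xpi|//] := ltgtP `|x| pi.
  have := @cos_gt0_pihalf _ (`|x| / 2); rewrite cx ltxx => h.
  by suff: false by []; apply: h; lra.
have := @cos_gt0_pihalf _ (`|x| / 2 - pi).
have -> : cos (`|x| / 2 - pi) = - cos (`|x| / 2).
  by rewrite cosB cospi sinpi; ring.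
rewrite cx oppr0 ltxx => h.
by suff: false by []; apply: h; lra.
Qed.

(* Each section [N_a] with [a != pi] has at most three points. *)
Let mu_xsection_N a : a != pi -> mu (xsection N a) = 0%E.
Proof.
move=> api; pose P := [set pi; a + pi; a - pi] : set R.
apply: countable_lebesgue_measure0; apply: (@sub_countable _ _ _ P); last first.
  by apply: finite_set_countable; rewrite /P !finite_setU; split; first split.
apply: subset_card_le => b.
rewrite /xsection/= inE => -[[]]; rewrite /I02pi/= !in_itv/= => aI bI S1.
have pi0 := pi_gt0 R.
have : cos (a / 2) * cos (b / 2) * cos ((a - b) / 2) = 0.
  by have := step2_sub1 a b; rewrite S1; lra.
move=> /eqP; rewrite !mulf_eq0 -orbA => /or3P[] /eqP /cos_half_eq0 h.
- by have [|E|E] := h; [lra|move: api; rewrite E eqxx|lra].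
- by have [|E|E] := h; [lra|left; left|lra].
- by have [|E|E] := h; [lra|right => /=; lra|left; right => /=; lra].
Qed.

Let mu2_N : mu2 N = 0%E.
Proof.
transitivity (\int[mu]_a (mu \o xsection N) a)%E; first by [].
rewrite (@ae_eq_integral _ _ _ mu setT (cst 0%E))//; first by rewrite integral0.
- exact: (measurable_fun_xsection mu measurable_N).
exists [set pi]; split => //; first exact: lebesgue_measure_set1.
move=> a /= h; apply: contrapT => api; apply: h => _.
by apply: mu_xsection_N; apply/eqP.
Qed.


Let f (z : R * R * R) : R := ln (Q z.1.1 z.1.2 z.2).
Let E : set (R * R * R) := ((I `*` I) `&` [set p | step2 p.1 p.2 != 1]) `*` I.

Let measurable_E : measurable E.
Proof.
apply: measurableX; last exact: measurable_itv.
apply: measurableI; first by apply: measurableX; exact: measurable_itv.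
rewrite (_ : [set _ | _] = ~` [set p : R * R | step2 p.1 p.2 = 1]).
  exact: measurableC.
by apply/seteqP; split => p /= /eqP.
Qed.

Let measurable_f : measurable_fun setT f.
Proof.
apply: measurableT_comp; first exact: measurable_ln.
have mc g : measurable_fun setT g -> measurable_fun setT (fun z : R * R * R => cos (g z)).
  by move=> mg; apply: measurableT_comp mg; apply: continuous_measurable_fun; exact: continuous_cos.
have ms g : measurable_fun setT g -> measurable_fun setT (fun z : R * R * R => sin (g z)).
  by move=> mg; apply: measurableT_comp mg; apply: continuous_measurable_fun; exact: continuous_sin.
have m1 : measurable_fun setT (fun z : R * R * R => z.1.1) by exact: measurableT_comp.
have m2 : measurable_fun setT (fun z : R * R * R => z.1.2) by exact: measurableT_comp.
apply: measurable_funD; apply: measurable_funX.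
  apply: measurable_funD; last exact: mc.
  apply: measurable_funD; last exact: mc.
  by apply: measurable_funD; last exact: mc.
apply: measurable_funD; last exact: ms.
by apply: measurable_funD; exact: ms.
Qed.

Let continuous_f p : step2 p.1 p.2 != 1 -> continuous (fun c => f (p, c)).
Proof.
rewrite step2_sqr => S1 c; exact: (continuous_ln_norm S1).
Qed.

(** [25 = 4^2 + 3^2], from the real and the imaginary part. *)
Let f_le p c : step2 p.1 p.2 != 1 -> f (p, c) <= ln 25.
Proof.
rewrite step2_sqr => S1; rewrite ler_ln ?posrE//; last exact: norm_circle_gt0.
rewrite /Q /=; have := cos_le1 p.1; have := cos_le1 p.2; have := cos_le1 c.
have := sin_le1 p.1; have := sin_le1 p.2; have := sin_le1 c.
have := cos_geN1 p.1; have := cos_geN1 p.2; have := cos_geN1 c.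
have := sin_geN1 p.1; have := sin_geN1 p.2; have := sin_geN1 c.
move: (cos _) (cos _) (cos _) (sin _) (sin _) (sin _) => x1 x2 x3 y1 y2 y3 *.
have sq (x m : R) : - m <= x -> x <= m -> x ^+ 2 <= m ^+ 2 by move=> *; nra.
have h1 : (1 + x3 + x2 + x1) ^+ 2 <= 4 ^+ 2 by apply: sq; lra.
have h2 : (y3 + y2 + y1) ^+ 2 <= 3 ^+ 2 by apply: sq; lra.
lra.
Qed.

Let pi2_gt0 : 0 < 2 * pi :> R.
Proof. by rewrite mulr_gt0// pi_gt0. Qed.

Let mu_I : mu I = (2 * pi)%:E.
Proof. by rewrite /I02pi lebesgue_measure_itv/= lte_fin pi2_gt0 -EFinB subr0. Qed.

Let integral_fE p : (\int[mu]_c ((f \_ E) (p, c))%:E =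
  (((fun p => 2 * pi * ln (step2 p.1 p.2)) \_ hexagon) p)%:E)%E.
Proof.
have [pI|pI] := boolP (p \in (I `*` I) `&` [set p | step2 p.1 p.2 != 1]).
  have [pII S1] := set_mem pI.
  transitivity (\int[mu]_(c in I) (f (p, c))%:E)%E.
    rewrite [RHS]integral_mkcond; apply: eq_integral => c _; rewrite !patchE.
    suff -> : ((p, c) \in E) = (c \in I) by case: ifPn.
    by apply/idP/idP; rewrite !inE; [move=> [] |move=> cI; split].
  have ci : mu.-integrable I (EFin \o (fun c => f (p, c))).
    exact: continuous_itv_integrable (continuous_f S1).
  rewrite -(fineK (integrable_fin_num _ ci)); last exact: measurable_itv.
  congr EFin; rewrite -[LHS]/(\int[mu]_(c in I) f (p, c)).
  rewrite /f/= Rintegral_ln_norm// patchE.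
  have [S1'|S1'] := leP (step2 p.1 p.2) 1.
    rewrite ln1 mulr0; case: ifPn => //; rewrite inE => -[_ /=].
    by rewrite ltNge S1'.
  by rewrite mem_set//; split.
rewrite patchE memNset; last first.
  move=> [pII /= S1]; move/negP : pI; apply; rewrite inE; split => //=.
  by rewrite gt_eqF.
rewrite integral0_eq// => c _; rewrite patchE memNset//= => -[/= pE _].
by move/negP: pI; apply; rewrite inE.
Qed.

(** There is no uniform lower bound for [f], but [f <= ln 25] gives [|f| <= 2 ln 25 - f], and
    Jensen's formula makes the integral of [f] nonnegative. Tonelli then yields integrability of [f]
    on [E]. *)
Let integral_abs_fE p : (\int[mu]_c `|((f \_ E) (p, c))%:E| <=
  ((cst (4 * pi * ln 25)%:E) \_ (I `*` I)) p)%E.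
Proof.
have L0 : 0 <= ln 25 :> R by apply: ln_ge0; lra.
have pi0 := pi_gt0 R.
have K0 : 0 <= 4 * pi * ln 25 :> R by rewrite mulr_ge0// mulr_ge0// ltW.
have [pI|pI] := boolP (p \in (I `*` I) `&` [set p | step2 p.1 p.2 != 1]); last first.
  rewrite integral0_eq//; last first.
    move=> c _; rewrite patchE memNset/= ?normr0// => -[/= pE _].
    by move/negP: pI; apply; rewrite inE.
  by rewrite patchE; case: ifPn.
have [pII S1] := set_mem pI.
rewrite patchE mem_set//.
have cf := continuous_f S1.
have cI : mu.-integrable I (EFin \o (fun c => `|f (p, c)|)).
  by apply: continuous_itv_integrable => c; apply: cvg_norm; exact: cf.
rewrite (_ : (\int[mu]_c _)%E = (\int[mu]_(c in I) (`|f (p, c)|)%:E)%E); last first.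
  rewrite [RHS]integral_mkcond; apply: eq_integral => c _; rewrite !patchE.
  suff -> : ((p, c) \in E) = (c \in I) by case: ifPn => //=; rewrite normr0.
  by apply/idP/idP; rewrite !inE; [move=> [] |move=> cI'; split].
rewrite -(fineK (integrable_fin_num _ cI)); last exact: measurable_itv.
rewrite lee_fin -[X in X <= _]/(\int[mu]_(c in I) `|f (p, c)|).
have c2 : continuous (fun c => 2 * ln 25 - f (p, c)).
  by move=> c; apply: cvgB; [exact: cvg_cst|exact: cf].
apply: (@le_trans _ _ (\int[mu]_(c in I) (2 * ln 25 - f (p, c)))).
  apply: le_Rintegral => //; first exact: measurable_itv.
    exact: continuous_itv_integrable.
  move=> c _; have := f_le c S1; move: (f _) => x xL.
  by rewrite ler_norml; apply/andP; split; lra.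
rewrite RintegralB//; first last.
- exact: continuous_itv_integrable.
- by apply: continuous_itv_integrable => c; exact: cvg_cst.
- exact: measurable_itv.
rewrite Rintegral_cst; last exact: measurable_itv.
rewrite /= mu_I /f/= Rintegral_ln_norm//.
have m1 : 0 <= ln (Num.max (step2 p.1 p.2) 1) by apply: ln_ge0; rewrite le_max lexx orbT.
have m2 : 0 <= 2 * pi * ln (Num.max (step2 p.1 p.2) 1) by rewrite mulr_ge0// ltW.
lra.
Qed.

Let mu2II : mu2 (I `*` I) = (2 * pi * (2 * pi))%:E.
Proof. by rewrite product_measure1E; [rewrite /= mu_I|exact: measurable_itv..]. Qed.

Let integrable_fE : mu3.-integrable setT (EFin \o (f \_ E)).
Proof.
have mfE : measurable_fun setT (EFin \o (f \_ E)).
  apply/measurable_EFinP; apply: (measurable_restrictT f measurable_E).1.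
  exact: measurable_funTS.
have mII : measurable (I `*` I) by apply: measurableX; exact: measurable_itv.
have mK := (measurable_restrictT (cst (4 * pi * ln 25)%:E) mII).1 (measurable_cst _).
have [_] := integrable12ltyP (@plane_measure R) mu mfE; apply.
apply: (@le_lt_trans _ _ (\int[mu2]_(p in I `*` I) (4 * pi * ln 25)%:E)%E).
  rewrite [leRHS]integral_mkcond; apply: ge0_le_integral => //.
  - by move=> p _; exact: integral_ge0.
  - have := measurable_fun_fubini_tonelli_F (m2 := mu) (abse \o (EFin \o (f \_ E))).
    apply; last by move=> z; exact: abse_ge0.
    by apply: measurableT_comp; [|exact: mfE].
  - exact: mK.
  - by move=> p _; exact: integral_abs_fE.
rewrite integral_cst; last by apply: measurableX; exact: measurable_itv.
have -> : ((4 * pi * ln 25)%:E * mu2 (I `*` I) =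
    (4 * pi * ln 25 * (2 * pi * (2 * pi)))%:E)%E.
  by rewrite [RHS]EFinM -mu2II.
by rewrite ltry.
Qed.

Lemma mahler_P3E :
  mahler_P3 R = (((2 * pi) ^+ 2)^-1 * \int[mu2]_(p in hexagon) ln (step2 p.1 p.2))%:E.
Proof.
have mX3 : measurable ((I `*` I) `*` I).
  by apply: measurableX; [apply: measurableX|]; exact: measurable_itv.
rewrite /mahler_P3.
have -> : (\int[mu3]_(p in (I `*` I) `*` I)
    (ln (Normc.normc (P3 (expi p.1.1) (expi p.1.2) (expi p.2))))%:E =
    \int[mu3]_(p in (I `*` I) `*` I) (EFin \o f) p)%E.
  by apply: eq_integral => p _; rewrite normc_P3.
have -> : (\int[mu3]_(p in (I `*` I) `*` I) (EFin \o f) p =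
    \int[mu3]_(p in (I `*` I) `*` I) ((EFin \o f) \_ E) p)%E.
  apply: ae_eq_integral => //.
  - by apply/measurable_EFinP; exact: measurable_funTS.
  - apply: measurable_funTS; apply: (measurable_restrictT _ measurable_E).1.
    by apply/measurable_EFinP; exact: measurable_funTS.
  exists (N `*` I); split.
  - by apply: measurableX; [exact: measurable_N|exact: measurable_itv].
  - transitivity (mu2 N * mu I)%E; last by rewrite mu2_N mul0e.
    by apply: product_measure1E; [exact: measurable_N|exact: measurable_itv].
  move=> [p c] /= h; apply: contrapT => pN; apply: h => -[/= pII cI].
  rewrite patchE mem_set//; split => //=; split => //=.
  by apply/negP => /eqP S1; apply: pN; split.
rewrite -integral_mkcondr (_ : _ `&` E = E); last first.
  by apply/seteqP; split => z []// [pII S1] cI; split.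
have -> : (\int[mu3]_(p in E) (EFin \o f) p = \int[mu3]_p ((f \_ E) p)%:E)%E.
  by rewrite integral_mkcond; apply: eq_integral => z _; rewrite restrict_EFin.
have <- := integral12_prod_meas1 integrable_fE; rewrite /fubini_F /=.
under eq_integral do rewrite integral_fE.
have mln : measurable_fun hexagon (fun p => ln (step2 p.1 p.2)).
  apply: measurable_funTS; apply: measurableT_comp; first exact: measurable_ln.
  exact: bounded_measurable_step2.1.
have lnb p : hexagon p -> `|ln (step2 p.1 p.2)| <= ln 9.
  move=> [_ /= S1]; rewrite ger0_norm; last by apply: ln_ge0; exact: ltW.
  by rewrite ler_ln ?posrE ?step2_le9//; exact: lt_trans S1.
have mh := @measurable_hexagon R; have muh := @mu2_hexagon R.
have bln : mu2.-integrable hexagon (EFin \o (fun p => ln (step2 p.1 p.2))).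
  by apply: (bounded_Rintegrable _ _ (M := ln 9)); [exact: mh|exact: muh|exact: mln|exact: lnb].
have i2ln : mu2.-integrable hexagon (EFin \o (fun p => 2 * pi * ln (step2 p.1 p.2))).
  apply: (bounded_Rintegrable _ _ (M := 2 * pi * ln 9)); [exact: mh|exact: muh| |].
    by apply: measurable_funM; [exact: measurable_cst|exact: mln].
  by move=> p hp; rewrite normrM gtr0_norm// ler_wpM2l ?lnb// ltW.
have -> : (\int[mu2]_p (((fun p => (2 * pi * ln (step2 p.1 p.2))%R) \_ hexagon) p)%:E =
    (2 * pi * \int[mu2]_(p in hexagon) ln (step2 p.1 p.2))%:E)%E.
  rewrite -RintegralZl; [|exact: mh|exact: bln].
  rewrite /Rintegral fineK; last first.
    by apply: integrable_fin_num; first [exact: mh|exact: i2ln].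
  by rewrite [RHS]integral_mkcond; apply: eq_integral => p _; rewrite restrict_EFin.
rewrite -EFinM; congr EFin; move: (\int[mu2]_(p in _) _) => J.
have : pi != 0 :> R by rewrite gt_eqF// pi_gt0.
by move: (pi) => x x0; field.
Qed.

End MahlerMeasure.

(** * Continuation along the negative axis and its limit *)

Section Continuation.
Context {R : realType}.
Implicit Types (p : R * R) (t x y : R).
Notation mu := (@lebesgue_measure R).
Notation mu2 := (mu \x mu)%E.
Notation hexagon := (@hexagon R).

Let S p : R := step2 p.1 p.2.
Notation kappa := (((2 * pi) ^+ 2)^-1 : R).
Let L t : R := \int[mu2]_(p in hexagon) ln (1 - t * S p).

Definition hexagon_continuation t : R :=
  kappa * (hexagon_moment 0 * ln (- t)
           - \int[mu2]_(p in hexagon) ln (1 - t * step2 p.1 p.2)).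
Notation g := hexagon_continuation.

Let S_gt1 p : hexagon p -> 1 < S p. Proof. by case. Qed.

Let kappa_ge0 : 0 <= kappa. Proof. by rewrite invr_ge0 sqr_ge0. Qed.

Let mS : measurable_fun hexagon S.
Proof. by apply: measurable_funTS; exact: bounded_measurable_step2.1. Qed.

Let hexagon_integrable (f : R * R -> R) (M : R) : measurable_fun hexagon f ->
  (forall p, hexagon p -> `|f p| <= M) -> mu2.-integrable hexagon (EFin \o f).
Proof.
move=> mf fM; apply: (bounded_Rintegrable _ _ (M := M)).
- exact: measurable_hexagon.
- exact: mu2_hexagon.
- exact: mf.
- exact: fM.
Qed.

Let hexagon_series (h : R * R -> R) (K y : R) : measurable_fun hexagon h ->
  (forall p, hexagon p -> `|h p| <= K) -> `|y| * K <= 2^-1 ->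
  series (fun k => (\int[mu2]_(p in hexagon) h p ^+ k.+1) / k.+1%:R * y ^+ k.+1) n
    @[n --> \oo] --> - \int[mu2]_(p in hexagon) ln (1 - y * h p).
Proof.
move=> mh hK yK; apply: (series_ln_integral _ _ _ _ yK).
- exact: measurable_hexagon.
- exact: mu2_hexagon.
- exact: mh.
- exact: hK.
Qed.

Let one_sub_gt1 t p : t < 0 -> hexagon p -> 1 < 1 - t * S p.
Proof. by move=> t0 /S_gt1 S1; nra. Qed.

Let mln (h : R * R -> R) : measurable_fun hexagon h ->
  measurable_fun hexagon (fun p => ln (h p)).
Proof. by move=> mh; apply: measurableT_comp mh; exact: measurable_ln. Qed.

Let m1B t : measurable_fun hexagon (fun p => 1 - t * S p).
Proof.
apply: measurable_funB; first exact: measurable_cst.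
by apply: measurable_funM; [exact: measurable_cst|exact: mS].
Qed.

Let integrable_L t : t < 0 ->
  mu2.-integrable hexagon (EFin \o (fun p => ln (1 - t * S p))).
Proof.
move=> t0; apply: (hexagon_integrable (M := ln (1 - t * 9))).
  exact: mln (m1B t).
move=> p hp; have := one_sub_gt1 t0 hp => h1.
rewrite ger0_norm; last by apply: ln_ge0; exact: ltW.
rewrite ler_ln ?posrE; [|lra|].
  by have := step2_le9 p.1 p.2; rewrite -/(S p) => ?; nra.
by rewrite (lt_trans _ (_ : 1 < _))//; lra.
Qed.

Let integrable_cst (r : R) : mu2.-integrable hexagon (EFin \o (fun=> r)).
Proof. exact: (hexagon_integrable (M := `|r|)). Qed.

Let Rintegral_hexagon_cst r :
  \int[mu2]_(p in hexagon) r = r * hexagon_moment 0.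
Proof.
rewrite /hexagon_moment -RintegralZl; [|exact: measurable_hexagon|].
  by apply: eq_Rintegral => p _; rewrite expr0 mulr1.
by under eq_fun do rewrite expr0; exact: integrable_cst.
Qed.

(** As [s <= 9], the radius [18^-1] ensures [|t s| <= 1/2]. *)
Lemma hexagon_continuation_series t : - 18^-1 < t < 0 ->
  series (fun k => kappa * hexagon_moment k.+1 / k.+1%:R * t ^+ k.+1) n
    @[n --> \oo] --> g t - kappa * hexagon_moment 0 * ln (- t).
Proof.
move=> /andP[t1 t0].
have -> : g t - kappa * hexagon_moment 0 * ln (- t) = kappa * - L t.
  by rewrite /hexagon_continuation -/(L t); ring.
have -> : series (fun k => kappa * hexagon_moment k.+1 / k.+1%:R * t ^+ k.+1) =
    fun n => kappa * series (fun k => (\int[mu2]_(p in hexagon) S p ^+ k.+1)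
      / k.+1%:R * t ^+ k.+1) n.
  by apply/funext => n; rewrite /series/= mulr_sumr; apply: eq_bigr => k _; rewrite !mulrA.
apply: cvgM; first exact: cvg_cst.
apply: (hexagon_series (K := 9)) => //.
- by move=> p hp; rewrite ger0_norm ?step2_le9// step2_ge0.
- by rewrite ltr0_norm//; lra.
Qed.

(** With [y = x - x0], [1 - x s = (1 - x0 s) (1 - y h)] and [x = x0 (1 - y h0)]. Both [h] and [h0]
    are at most [1 / |x0|] in absolute value, hence the radius [|x0| / 2] and a Taylor series from
    two logarithmic expansions. *)
Lemma hexagon_continuation_analytic : real_analytic_on `]-oo, 0[ g.
Proof.
move=> x0 /=; rewrite in_itv/= => x00.
pose h p := S p / (1 - x0 * S p); pose h0 p : R := - x0^-1.
have nx0 : 0 < - x0 by lra.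
have mh : measurable_fun hexagon h.
  apply: measurable_funM; first exact: mS.
  (* The inverse of the positive function [1 - x0 s] is written as an exponential of minus its
     logarithm, which is visibly measurable. *)
  have mE : measurable_fun hexagon (fun p => expR (- ln (1 - x0 * S p))).
    apply: measurableT_comp; first exact: measurable_expR.
    by apply: measurable_funN; exact: mln (m1B x0).
  apply: eq_measurable_fun mE => p; rewrite inE => hp.
  have d1 : 0 < 1 - x0 * S p by rewrite (lt_trans _ (one_sub_gt1 x00 hp)).
  by rewrite expRN lnK ?posrE.
have hB p : hexagon p -> `|h p| <= (- x0)^-1.
  move=> hp; have S1 := S_gt1 hp; have d1 := one_sub_gt1 x00 hp.
  rewrite ger0_norm; last by rewrite divr_ge0//; lra.
  by rewrite ler_pdivrMr; [rewrite ler_pdivlMl//; lra|lra].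
have h0B p : hexagon p -> `|h0 p| <= (- x0)^-1.
  by move=> _; rewrite /h0 -invrN ger0_norm// invr_ge0 ltW.
exists (- x0 / 2); first lra.
exists (fun k => if k is j.+1 then kappa * (\int[mu2]_(p in hexagon) h p ^+ j.+1
    - \int[mu2]_(p in hexagon) h0 p ^+ j.+1) / j.+1%:R else g x0) => x xr.
set y := x - x0 in xr *.
have yK : `|y| * (- x0)^-1 <= 2^-1 by rewrite ler_pdivrMr//; lra.
have [y1 y2] : - (- x0 / 2) < y /\ y < - x0 / 2 by move: xr; rewrite ltr_norml => /andP[].
have xlt0 : x < 0 by rewrite /y in y2; lra.
have s1 := hexagon_series mh hB yK.
have s0 := hexagon_series (measurable_cst _ : measurable_fun hexagon h0) h0B yK.
have -> : g x = g x0 + kappa * (- (\int[mu2]_(p in hexagon) ln (1 - y * h p))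
    - - (\int[mu2]_(p in hexagon) ln (1 - y * h0 p))).
  have -> : \int[mu2]_(p in hexagon) ln (1 - y * h p) = L x - L x0.
    rewrite /L -RintegralB; [|exact: measurable_hexagon|exact: integrable_L..].
    apply: eq_Rintegral => p; rewrite inE => hp.
    have d0 := one_sub_gt1 x00 hp; have d1 := one_sub_gt1 xlt0 hp.
    rewrite -ln_div ?posrE; [|lra..]; congr ln; rewrite /h /y.
    by field; rewrite gt_eqF//; lra.
  rewrite /h0 Rintegral_hexagon_cst.
  have -> : ln (1 - y * - x0^-1) = ln (- x) - ln (- x0).
    rewrite -ln_div ?posrE; [|lra..]; congr ln; rewrite /y.
    by field; rewrite lt_eqF.
  by rewrite /hexagon_continuation -/(L x) -/(L x0); ring.
rewrite -cvg_shiftS /=.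
rewrite (_ : (fun n => _) = fun n => g x0 + kappa *
   (series (fun k => (\int[mu2]_(p in hexagon) h p ^+ k.+1) / k.+1%:R * y ^+ k.+1) n
  - series (fun k => (\int[mu2]_(p in hexagon) h0 p ^+ k.+1) / k.+1%:R * y ^+ k.+1) n)).
  apply: cvgD; first exact: cvg_cst.
  by apply: cvgM; [exact: cvg_cst|exact: cvgB].
apply/funext => n; rewrite /series/= big_nat_recl// expr0 mulr1; congr +%R.
by rewrite -sumrB mulr_sumr; apply: eq_bigr => k _; ring.
Qed.

(** The difference of the integrands is [- ln (1 + 1 / (- x s))], of size at most [1 / (- x)]
    because [s > 1] on the hexagon. The divergent [ln (- x)] is absorbed exactly, its coefficient
    being the area. *)
Lemma hexagon_continuation_cvg :
  - g x @[x --> -oo] --> kappa * \int[mu2]_(p in hexagon) ln (step2 p.1 p.2).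
Proof.
have m0 : 0 <= kappa * hexagon_moment 0.
  by rewrite mulr_ge0//; apply: Rintegral_ge0 => p _; rewrite expr0.
have iS : mu2.-integrable hexagon (EFin \o (fun p => ln (S p))).
  apply: (hexagon_integrable (M := ln 9)); first exact: mln mS.
  move=> p hp; have S1 := S_gt1 hp; rewrite ger0_norm; last by apply: ln_ge0; exact: ltW.
  by rewrite ler_ln ?posrE ?step2_le9//; lra.
apply/cvgrPdist_le => /= e e0; near=> x.
have x0 : x < 0 by near: x; apply: nbhs_ninfty_lt; exact: num_real.
have xe : x <= - (kappa * hexagon_moment 0 / e) by near: x; apply: nbhs_ninfty_le; exact: num_real.
have nx0 : 0 < - x by lra.
pose d p := ln (S p) - (ln (1 - x * S p) - ln (- x)).
have -> : kappa * \int[mu2]_(p in hexagon) ln (S p) - - g x =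
    kappa * \int[mu2]_(p in hexagon) d p.
  have iB : mu2.-integrable hexagon (EFin \o (fun p => ln (1 - x * S p) - ln (- x))).
    exact: (@integrableB _ _ _ mu2 hexagon (@measurable_hexagon R) _ _
      (integrable_L x0) (integrable_cst (ln (- x)))).
  rewrite /d RintegralB; [|exact: measurable_hexagon|exact: iS|exact: iB].
  rewrite RintegralB; [|exact: measurable_hexagon|exact: integrable_L|exact: integrable_cst].
  by rewrite Rintegral_hexagon_cst -/(L x) /hexagon_continuation -/(L x) /S; ring.
have md : measurable_fun hexagon d.
  apply: measurable_funB; first exact: mln mS.
  by apply: measurable_funB; [exact: mln (m1B x)|exact: measurable_cst].
have dB p : hexagon p -> `|d p| <= (- x)^-1.
  move=> hp; have S1 := S_gt1 hp; have d1 := one_sub_gt1 x0 hp.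
  have -> : d p = - ln (1 + (- x * S p)^-1).
    rewrite /d -ln_div ?posrE; [|lra..]; rewrite -ln_div ?posrE; [|lra|]; last first.
      by rewrite divr_gt0//; lra.
    rewrite -lnV ?posrE; last first.
      by rewrite addr_gt0// invr_gt0 mulr_gt0//; lra.
    congr ln; field; apply/and3P; split; [|by rewrite lt_eqF|];
      by rewrite gt_eqF//; lra.
  have z0 : 0 < (- x * S p)^-1 by rewrite invr_gt0 mulr_gt0//; lra.
  rewrite normrN ger0_norm; last by apply: ln_ge0; lra.
  apply: (le_trans (le_ln1Dx _)); first lra.
  by rewrite lef_pV2 ?posrE ?mulr_gt0//; [nra|lra].
have id := hexagon_integrable md dB.
rewrite normrM ger0_norm//.
apply: (@le_trans _ _ (kappa * ((- x)^-1 * hexagon_moment 0))).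
  rewrite ler_wpM2l// -Rintegral_hexagon_cst.
  apply: le_trans (le_normr_Rintegral _ id) _; first exact: measurable_hexagon.
  by apply: le_Rintegral; first [exact: measurable_hexagon|exact: integrable_cst
    |exact: integrable_norm|exact: dB].
rewrite mulrCA -ler_pdivlMl ?invr_gt0// invrK.
by move: xe; rewrite lerNr -ler_pdivrMr.
Unshelve. all: by end_near. Qed.

End Continuation.

(** * Identification of the coefficients and conclusion *)

Lemma hexagon_moment_coef (R : realType) (c : nat -> R) :
  c 0%N = 3 / 4 ->
  (forall k, k.+1%:R ^+ 2 * c k.+1 - (10 * k%:R ^+ 2 + 10 * k%:R + 3) * c k
    + 9 * k%:R ^+ 2 * c k.-1 = 6 / pi ^+ 2) ->
  forall n, c n = ((2 * pi) ^+ 2)^-1 * hexagon_moment n.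
Proof.
move=> c0 crec; have pi0 : pi != 0 :> R by rewrite gt_eqF// pi_gt0.
pose m n : R := ((2 * pi) ^+ 2)^-1 * hexagon_moment n.
have m0 : m 0%N = 3 / 4.
  by rewrite /m hexagon_moment0; move: (pi) pi0 => x x0; field.
have mrec k : k.+1%:R ^+ 2 * m k.+1 - (10 * k%:R ^+ 2 + 10 * k%:R + 3) * m k
    + 9 * k%:R ^+ 2 * m k.-1 = 6 / pi ^+ 2.
  have -> : 6 / pi ^+ 2 = ((2 * pi) ^+ 2)^-1 * 24 :> R.
    by move: (pi) pi0 => x x0; field.
  by rewrite -(hexagon_moment_rec k) /m; ring.
suff cm n : c n = m n /\ c n.+1 = m n.+1 by move=> n; case: (cm n).
(* The leading coefficient [(k + 1)^2] never vanishes, so the value at 0 determines the sequence. *)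
have step k : c k = m k -> c k.-1 = m k.-1 -> c k.+1 = m k.+1.
  move=> ck ck1; have k0 : k.+1%:R ^+ 2 != 0 :> R by rewrite sqrf_eq0 pnatr_eq0.
  by apply: (mulfI k0); have := crec k; have := mrec k; rewrite ck ck1; lra.
elim: n => [|n [cn cn1]]; first by split; [|apply: step]; rewrite ?c0 ?m0.
by split => //; exact: step.
Qed.

Unset Implicit Arguments.

(* a = Taylor coefficients of phi (L_2 phi = 0, phi = 1 + 3t + O(t^2)),
   b = Taylor coefficients of psi (L_2 psi = t/(1-t), psi = t + O(t^2)),
   c = coefficients of (3/4) phi + (6/pi^2) psi.
   Re of (t d/dt)^{-1}[...] on (-eps,0) is c_0 log|t| + sum_{m>=1} c_m/m t^m;
   g is its (real-analytic) continuation along (-oo,0). *)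
Theorem theorem4p2 (R : realType) (a b : nat -> R) :
  (forall n, L2coef a n = 0) -> a 0%N = 1 -> a 1%N = 3 ->
  (forall n, L2coef b n = t_over_1mt_coef R n) -> b 0%N = 0 -> b 1%N = 1 ->
  let c := fun n => 3 / 4 * a n + 6 / pi ^+ 2 * b n in
  exists g : R -> R,
    [/\ real_analytic_on `]-oo, 0[ g,
        (exists2 eps : R, 0 < eps &
           forall t, - eps < t < 0 ->
             series (fun m => c m.+1 / (m.+1)%:R * t ^+ m.+1) n @[n --> \oo]
               --> g t - c 0%N * ln (- t)) &
        exists M : R, (- g x @[x --> -oo] --> M) /\ mahler_P3 R = M%:E].
Proof.
move=> aL a0 a1 bL b0 b1 c.
have pi0 : pi != 0 :> R by rewrite gt_eqF// pi_gt0.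
(* This is [L2coef] at [n = k + 1]. For [k = 0] its absent third term agrees with the one containing
   [a k.-1], whose factor [k^2] is 0. *)
have arec k : k.+1%:R ^+ 2 * a k.+1 - (10 * k%:R ^+ 2 + 10 * k%:R + 3) * a k
    + 9 * k%:R ^+ 2 * a k.-1 = 0.
  rewrite -(aL k.+1) /L2coef; case: k => [|k] //.
  by rewrite /=; ring.
have brec k : k.+1%:R ^+ 2 * b k.+1 - (10 * k%:R ^+ 2 + 10 * k%:R + 3) * b k
    + 9 * k%:R ^+ 2 * b k.-1 = 1.
  rewrite -[RHS](bL k.+1) /L2coef; case: k => [|k] //.
  by rewrite /=; ring.
have cE : forall n, c n = ((2 * pi) ^+ 2)^-1 * hexagon_moment n.
  apply: hexagon_moment_coef => [|k]; first by rewrite /c a0 b0; lra.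
  rewrite /c; move: (6 / pi ^+ 2) => w.
  have := congr2 (fun x y => 3 / 4 * x + w * y) (arec k) (brec k).
  by rewrite mulr0 add0r mulr1 => E; apply: etrans E; ring.
exists (@hexagon_continuation R); split.
- exact: hexagon_continuation_analytic.
- exists 18^-1; first by rewrite invr_gt0.
  move=> t t0; have -> : (fun k => c k.+1 / k.+1%:R * t ^+ k.+1) =
      fun k => ((2 * pi) ^+ 2)^-1 * hexagon_moment k.+1 / k.+1%:R * t ^+ k.+1.
    by apply/funext => k; rewrite cE.
  by rewrite cE; exact: hexagon_continuation_series.
- exists (((2 * pi) ^+ 2)^-1 *
    (\int[(@lebesgue_measure R \x @lebesgue_measure R)%E]_(p in hexagon) ln (step2 p.1 p.2))%R).
  by split; [exact: hexagon_continuation_cvg|exact: mahler_P3E].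
Qed.
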